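(* Let $\pi$ be a discrete group, $A=\{A_\alpha\}_{\alpha\in\pi}$ a family of associative algebras over $\mathbb{C}$ with nondegenerate products, and $\Delta=\{\Delta_{\alpha,\beta}:A_{\alpha\beta}\to M(A_\alpha\otimes A_\beta)\}_{\alpha,\beta\in\pi}$ a family of homomorphisms. Then $A$ (with $\Delta$ and a suitable counit and antipode) is a Hopf $\pi$-coalgebra if and only if $(A,\Delta)$ is a multiplier Hopf $\pi$-coalgebra and every component $A_\alpha$ is unital.
   Context: A product is nondegenerate if $ab=0$ for all $a$ implies $b=0$, and $ab=0$ for all $b$ implies $a=0$. The multiplier algebra $M(A)$ consists of pairs $(L,R)$ of linear maps $A\to A$ with $L(ab)=L(a)b$, $R(ab)=aR(b)$, $R(a)b=aL(b)$; for $x=(L,R)$ write $xa=L(a)$, $ax=R(a)$; $A\otimes B\subseteq M(A)\otimes M(B)\subseteq M(A\otimes B)$. If $A$ is unital then $M(A)=A$. $I$ is the identity map; the identity of $\pi$ is $1$. Multiplier Hopf $\pi$-coalgebra: $\Delta$ is a family of homomorphisms $\Delta_{\alpha,\beta}:A_{\alpha\beta}\to M(A_\alpha\otimes A_\beta)$ such that for all $\alpha,\beta,\gamma\in\pi$: (1) $\Delta_{\alpha,\beta}(a)(1\otimes b)\in A_\alpha\otimes A_\beta$ for $a\in A_{\alpha\beta}$, $b\in A_\beta$, and $(a\otimes 1)\Delta_{\alpha,\beta}(b)\in A_\alpha\otimes A_\beta$ for $a\in A_\alpha$, $b\in A_{\alpha\beta}$; (2) $(a\otimes1\otimes1)(\Delta_{\alpha,\beta}\otimes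 I)(\Delta_{\alpha\beta,\gamma}(b)(1\otimes c))=(I\otimes\Delta_{\beta,\gamma})((a\otimes1)\Delta_{\alpha,\beta\gamma}(b))(1\otimes1\otimes c)$ for $a\in A_\alpha$, $b\in A_{\alpha\beta\gamma}$, $c\in A_\gamma$; (3) the linear maps $T^1_{\alpha,\beta}:A_{\alpha\beta}\otimes A_\beta\to A_\alpha\otimes A_\beta$, $a\otimes b\mapsto\Delta_{\alpha,\beta}(a)(1\otimes b)$, and $T^2_{\alpha,\beta}:A_\alpha\otimes A_{\alpha\beta}\to A_\alpha\otimes A_\beta$, $a\otimes b\mapsto(a\otimes1)\Delta_{\alpha,\beta}(b)$, are bijective. Hopf $\pi$-coalgebra (Turaev): a family $\{A_\alpha\}_{\alpha\in\pi}$ of unital associative $\mathbb{C}$-algebras, with multiplication $m_\alpha$ and unit $1_\alpha$, with algebra homomorphisms $\Delta_{\alpha,\beta}:A_{\alpha\beta}\to A_\alpha\otimes A_\beta$ and $\varepsilon:A_1\to\mathbb{C}$ and linear maps $S_\alpha:A_\alpha\to A_{\alpha^{-1}}$ such that for all $\alpha,\beta,\gamma\in\pi$: $(\Delta_{\alpha,\beta}\otimes I)\Delta_{\alpha\beta,\gamma}=(I\otimes\Delta_{\beta,\gamma})\Delta_{\alpha,\beta\gamma}$; $(I\otimes\varepsilon)\Delta_{\alpha,1}=(\varepsilon\otimes I)\Delta_{1,\alpha}=I$; and $m_\alpha(S_{\alpha^{-1}}\otimes I)\Delta_{\alpha^{-1},\alpha}=\varepsilon 1_\alpha=m_\alpha(I\otimes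 S_{\alpha^{-1}})\Delta_{\alpha,\alpha^{-1}}$.
   Formalization: The counit is required to preserve the unit only when 1 is nonzero in A_1: the zero family (all A_α = 0) is a unital multiplier Hopf π-coalgebra but has no unit-preserving homomorphism to C, so it is counted here as a Hopf π-coalgebra. *)

(* Defs.v *)
From HB Require Import structures.
From mathcomp Require Import all_boot all_order all_algebra generic_quotient.
From mathcomp Require Import boolp.
Set Implicit Arguments.
Unset Strict Implicit.
Unset Printing Implicit Defensive.
Import GRing.Theory.
Local Open Scope ring_scope.
Local Open Scope quotient_scope.
Local Obligation Tactic := idtac.

Notation bilin f := (bilinear_for *:%R *:%R f).

(* MathComp's algebra structures are unital, hence the structure of a
   not necessarily unital associative algebra over a field. *)
HB.mixin Record Lmodule_isNAlgebra (K : fieldType) V of GRing.Lmodule K V := {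
  nmul : V -> V -> V;
  nmulA : associative nmul;
  nmulPl : forall (k : K) (b x y : V),
    nmul (k *: x + y) b = k *: nmul x b + nmul y b;
  nmulPr : forall (k : K) (a x y : V),
    nmul a (k *: x + y) = k *: nmul a x + nmul a y
}.

#[short(type="nalgType")]
HB.structure Definition NAlgebra (K : fieldType) :=
  {V of Lmodule_isNAlgebra K V & GRing.Lmodule K V}.

Notation "x ** y" := (nmul x y) (at level 40, left associativity).

Lemma lin0 (K : fieldType) (V W : lmodType K) (g : V -> W) : linear g -> g 0 = 0.
Proof. by move=> h; have := h (-1) 0 0; rewrite scaler0 addr0 scaleN1r addNr. Qed.
Lemma linD (K : fieldType) (V W : lmodType K) (g : V -> W) :
  linear g -> forall x y, g (x + y) = g x + g y.
Proof. by move=> h x y; have := h 1 x y; rewrite !scale1r. Qed.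
Lemma linZ (K : fieldType) (V W : lmodType K) (g : V -> W) :
  linear g -> forall k x, g (k *: x) = k *: g x.
Proof. by move=> h k x; have := h k x 0; rewrite !addr0 (lin0 h) addr0. Qed.

Section NAlgebraTheory.
Variables (K : fieldType) (A B : nalgType K).

Definition nondegenerate_mul :=
  (forall b : A, (forall a : A, a ** b = 0) -> b = 0) /\
  (forall a : A, (forall b : A, a ** b = 0) -> a = 0).

Definition is_unit (u : A) := forall a : A, u ** a = a /\ a ** u = a.

Definition unital := exists u : A, is_unit u.

Definition is_alg_hom (f : A -> B) := linear f /\ {morph f : x y / x ** y}.

Lemma nmul_bilin : bilin (@nmul K A).
Proof. by split=> u k x y; rewrite ?nmulPl ?nmulPr. Qed.

Lemma nmulDl (x y b : A) : (x + y) ** b = x ** b + y ** b.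
Proof. exact: (linD (nmul_bilin.1 b)). Qed.
Lemma nmulDr (b x y : A) : b ** (x + y) = b ** x + b ** y.
Proof. exact: (linD (nmul_bilin.2 b)). Qed.
Lemma nmulZl k (x b : A) : (k *: x) ** b = k *: (x ** b).
Proof. exact: (linZ (nmul_bilin.1 b)). Qed.
Lemma nmulZr k (b x : A) : b ** (k *: x) = k *: (b ** x).
Proof. exact: (linZ (nmul_bilin.2 b)). Qed.
Lemma nmul0l (b : A) : 0 ** b = 0. Proof. exact: (lin0 (nmul_bilin.1 b)). Qed.
Lemma nmul0r (b : A) : b ** 0 = 0. Proof. exact: (lin0 (nmul_bilin.2 b)). Qed.
End NAlgebraTheory.

(* The tensor product of two K-vector spaces: formal sums of pairs modulo the
   congruence generated by the bilinearity relations. Scalars are absorbed in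
   the pairs. *)
Section TensorType.
Variables (K : fieldType) (A B : lmodType K).

Inductive tens_eq : seq (A * B) -> seq (A * B) -> Prop :=
| teq_refl s : tens_eq s s
| teq_sym s t : tens_eq s t -> tens_eq t s
| teq_trans s t u : tens_eq s t -> tens_eq t u -> tens_eq s u
| teq_cat s s' t t' : tens_eq s s' -> tens_eq t t' -> tens_eq (s ++ t) (s' ++ t')
| teq_catC s t : tens_eq (s ++ t) (t ++ s)
| teq_0 b : tens_eq [:: (0, b)] [::]
| teq_Dl a a' b : tens_eq [:: (a + a', b)] [:: (a, b); (a', b)]
| teq_Dr a b b' : tens_eq [:: (a, b + b')] [:: (a, b); (a, b')]
| teq_Z k a b : tens_eq [:: (k *: a, b)] [:: (a, k *: b)].

Definition tens_rel : rel (seq (A * B)) := fun s t => `[< tens_eq s t >].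

Fact tens_rel_equiv : equiv_class_of tens_rel.
Proof.
split=> [s|s t|t s u].
- by apply/asboolP; apply: teq_refl.
- by apply/asboolP/asboolP; apply: teq_sym.
- by move=> /asboolP h1 /asboolP h2; apply/asboolP; apply: teq_trans h1 h2.
Qed.

Canonical tens_equiv := EquivRelPack tens_rel_equiv.

Definition tensor : Type := {eq_quot tens_rel}.
HB.instance Definition _ := Choice.copy tensor {eq_quot tens_rel}.
HB.instance Definition _ := EqQuotient.copy tensor {eq_quot tens_rel}.

Lemma tensP (s t : seq (A * B)) :
  (\pi_tensor s = \pi_tensor t) <-> tens_eq s t.
Proof.
split; first by move/eqmodP/asboolP.
by move=> h; apply/eqmodP/asboolP.
Qed.

Lemma tens_repr (s : seq (A * B)) : tens_eq (repr (\pi_tensor s)) s.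
Proof. by apply/tensP; rewrite reprK. Qed.

Definition tens0 : tensor := \pi_tensor [::].
Definition tens_add (x y : tensor) : tensor := \pi_tensor (repr x ++ repr y).
Definition tens_scale (k : K) (x : tensor) : tensor :=
  \pi_tensor [seq (k *: p.1, p.2) | p <- repr x].
Definition tens_opp (x : tensor) : tensor := tens_scale (-1) x.

Lemma tens_addE s t :
  tens_add (\pi_tensor s) (\pi_tensor t) = \pi_tensor (s ++ t).
Proof. by apply/tensP/teq_cat; apply: tens_repr. Qed.

Lemma teq_map k s t : tens_eq s t ->
  tens_eq [seq (k *: p.1, p.2) | p <- s] [seq (k *: p.1, p.2) | p <- t].
Proof.
elim=> {s t} [s|s t _|s t u _ h1 _ h2|s s' t t' _ h1 _ h2|s t|b|a a' b|a b b'|l a b] /=.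
- exact: teq_refl.
- exact: teq_sym.
- exact: teq_trans h1 h2.
- by rewrite !map_cat; apply: teq_cat.
- by rewrite !map_cat; apply: teq_catC.
- by rewrite scaler0; apply: teq_0.
- by rewrite scalerDr; apply: teq_Dl.
- exact: teq_Dr.
- by rewrite scalerA mulrC -scalerA; apply: teq_Z.
Qed.

Lemma tens_scaleE k s : tens_scale k (\pi_tensor s) =
  \pi_tensor [seq (k *: p.1, p.2) | p <- s].
Proof. by apply/tensP/teq_map/tens_repr. Qed.

Lemma tens_piW (P : tensor -> Prop) :
  (forall s, P (\pi_tensor s)) -> forall x, P x.
Proof. by move=> h x; rewrite -[x]reprK; apply: h. Qed.

Fact tens_addA : associative tens_add.
Proof.
by elim/tens_piW=> s; elim/tens_piW=> t; elim/tens_piW=> u;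
  rewrite !tens_addE catA.
Qed.

Fact tens_addC : commutative tens_add.
Proof.
elim/tens_piW=> s; elim/tens_piW=> t.
by rewrite !tens_addE; apply/tensP/teq_catC.
Qed.

Fact tens_add0 : left_id tens0 tens_add.
Proof. by elim/tens_piW=> s; rewrite tens_addE. Qed.

Fact tens_scaleA k l x : tens_scale k (tens_scale l x) = tens_scale (k * l) x.
Proof.
elim/tens_piW: x => s; rewrite !tens_scaleE -map_comp; congr (\pi_tensor _).
by apply: eq_map => p /=; rewrite scalerA.
Qed.

Fact tens_scale1 : left_id 1 tens_scale.
Proof.
elim/tens_piW=> s; rewrite tens_scaleE; congr (\pi_tensor _).
by rewrite -[RHS]map_id; apply: eq_map => -[a b] /=; rewrite scale1r.
Qed.

Fact tens_scaleDr : right_distributive tens_scale tens_add.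
Proof.
move=> k; elim/tens_piW=> s; elim/tens_piW=> t.
by rewrite !(tens_addE, tens_scaleE) map_cat.
Qed.

Fact tens_scaleDl x : {morph tens_scale^~ x : k l / k + l >-> tens_add k l}.
Proof.
move=> k l; elim/tens_piW: x => s; rewrite !tens_scaleE tens_addE.
apply/tensP; elim: s => [|[a b] s ih] /=; first exact: teq_refl.
rewrite scalerDl -[_ :: _]/([:: (k *: a + l *: a, b)] ++ _).
apply: teq_trans (teq_cat (teq_Dl _ _ _) ih) _ => /=.
rewrite -[X in tens_eq X _]/([:: (k *: a, b)] ++ ([:: (l *: a, b)] ++ _ ++ _)).
rewrite -[X in tens_eq _ X]/([:: (k *: a, b)] ++ (_ ++ ([:: (l *: a, b)] ++ _))).
apply: teq_cat; first exact: teq_refl.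
rewrite !catA; apply: teq_cat; last exact: teq_refl.
exact: teq_catC.
Qed.

Fact tens_addN : left_inverse tens0 tens_opp tens_add.
Proof.
move=> x; rewrite /tens_opp -{2}[x]tens_scale1 -tens_scaleDl addNr.
elim/tens_piW: x => s; rewrite tens_scaleE; apply/tensP.
elim: s => [|[a b] s ih] /=; first exact: teq_refl.
by rewrite scale0r; apply: (teq_cat (teq_0 b) ih).
Qed.

HB.instance Definition _ :=
  GRing.isZmodule.Build tensor tens_addA tens_addC tens_add0 tens_addN.
HB.instance Definition _ := GRing.Zmodule_isLmodule.Build K tensor
  tens_scaleA tens_scale1 tens_scaleDr tens_scaleDl.

Definition tens (a : A) (b : B) : tensor := \pi_tensor [:: (a, b)].

Fact tens_bilin : bilin tens.
Proof.
split=> [b k x y|a k x y].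
- rewrite -[RHS]/(tens_add (tens_scale k (tens x b)) (tens y b)).
  by rewrite tens_scaleE tens_addE; apply/tensP; apply: teq_Dl.
- rewrite -[RHS]/(tens_add (tens_scale k (tens a x)) (tens a y)).
  rewrite tens_scaleE tens_addE; apply/tensP.
  apply: teq_trans (teq_Dr _ _ _) _.
  rewrite -cat1s -[X in tens_eq _ X]cat1s.
  by apply: teq_cat; [apply/teq_sym/teq_Z | apply: teq_refl].
Qed.

Lemma tens_ind (P : tensor -> Prop) :
  P 0 -> (forall a b, P (tens a b)) -> (forall x y, P x -> P y -> P (x + y)) ->
  forall x, P x.
Proof.
move=> P0 Pt PD; elim/tens_piW; elim=> [|[a b] s ih] //.
rewrite -cat1s -tens_addE; exact: (PD (tens a b) (\pi_tensor s) (Pt a b) ih).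
Qed.

(* The linear map induced by a bilinear map f (see tliftE, tlift_linear and
   tlift_unique; meaningful only when f is bilinear). *)
Definition tlift (V : lmodType K) (f : A -> B -> V) (x : tensor) : V :=
  \sum_(p <- repr x) f p.1 p.2.

Section Lift.
Variables (V : lmodType K) (f : A -> B -> V).
Hypothesis hf : bilin f.

Let fDl a a' b : f (a + a') b = f a b + f a' b.
Proof. by have /= := hf.1 b 1 a a'; rewrite !scale1r. Qed.
Let fDr a b b' : f a (b + b') = f a b + f a b'.
Proof. by have /= := hf.2 a 1 b b'; rewrite !scale1r. Qed.
Let f0 b : f 0 b = 0.
Proof. by apply: (addrI (f 0 b)); rewrite -fDl !addr0. Qed.
Let fr0 a : f a 0 = 0.
Proof. by apply: (addrI (f a 0)); rewrite -fDr !addr0. Qed.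
Let fZ k a b : f (k *: a) b = k *: f a b.
Proof. by have /= := hf.1 b k a 0; rewrite !addr0 f0 addr0. Qed.
Let fZr k a b : f a (k *: b) = k *: f a b.
Proof. by have /= := hf.2 a k b 0; rewrite !addr0 fr0 addr0. Qed.

Lemma tlift_pi s : tlift f (\pi_tensor s) = \sum_(p <- s) f p.1 p.2.
Proof.
rewrite /tlift; move: (repr _) (tens_repr s) => r; elim=> {r s} //.
- by move=> s t u _ -> _ ->.
- by move=> s s' t t' _ h _ h'; rewrite !big_cat /= h h'.
- by move=> s t; rewrite !big_cat /= addrC.
- by move=> b; rewrite big_nil big_seq1 f0.
- by move=> a a' b; rewrite !big_cons !big_nil /= !addr0.
- by move=> a b b'; rewrite !big_cons !big_nil /= !addr0.
- by move=> k a b; rewrite !big_seq1 /= fZ fZr.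
Qed.

Lemma tliftE a b : tlift f (tens a b) = f a b.
Proof. by rewrite tlift_pi big_seq1. Qed.

Lemma tlift_linear : linear (tlift f).
Proof.
move=> k; elim/tens_piW=> s; elim/tens_piW=> t.
rewrite -[k *: _ + _]/(tens_add (tens_scale k _) _) tens_scaleE tens_addE.
rewrite !tlift_pi big_cat big_map /=; congr (_ + _).
by rewrite scaler_sumr; apply: eq_bigr => p _; rewrite fZ.
Qed.
End Lift.

Lemma tlift_unique (V : lmodType K) (g h : tensor -> V) :
  linear g -> linear h -> (forall a b, g (tens a b) = h (tens a b)) -> g =1 h.
Proof.
move=> lg lh e; apply: tens_ind => [|//|x y gx gy]; first by rewrite !lin0.
by rewrite !linD // gx gy.
Qed.
End TensorType.

Notation "a ⊗ b" := (tens a b) (at level 40, left associativity).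

Section TensorMap.
Variables (K : fieldType) (A A' B B' : lmodType K).

Definition tmap (f : A -> A') (g : B -> B') : tensor A B -> tensor A' B' :=
  tlift (fun a b => f a ⊗ g b).

Variables (f : A -> A') (g : B -> B').
Hypotheses (lf : linear f) (lg : linear g).

Lemma tmap_bilin : bilin (fun a b => f a ⊗ g b).
Proof.
by split=> [b|a] k x y /=; rewrite ?lf ?lg;
  [apply: (tens_bilin _ _).1 | apply: (tens_bilin _ _).2].
Qed.

Lemma tmapE a b : tmap f g (a ⊗ b) = f a ⊗ g b.
Proof. exact: tliftE tmap_bilin a b. Qed.

Lemma tmap_linear : linear (tmap f g).
Proof. exact: tlift_linear tmap_bilin. Qed.
End TensorMap.

Section TensorAlgebra.
Variables (K : fieldType) (A B : nalgType K).

Definition tens_mul (x y : tensor A B) : tensor A B :=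
  tlift (fun a b => tmap (nmul a) (nmul b) y) x.

Let tl a b := tmap_linear ((nmul_bilin A).2 a) ((nmul_bilin B).2 b).

Let tens_mul_bil y : bilin (fun (a : A) (b : B) => tmap (nmul a) (nmul b) y).
Proof.
split=> [b|a] k x x' /=; elim/tens_ind: y => [|c d|y z ihy ihz].
- by rewrite !(lin0 (tl _ _)) scaler0 addr0.
- rewrite !(tmapE ((nmul_bilin A).2 _) ((nmul_bilin B).2 _)) nmulPl.
  exact: (tens_bilin A B).1.
- by rewrite !(linD (tl _ _)) ihy ihz scalerDr addrACA.
- by rewrite !(lin0 (tl _ _)) scaler0 addr0.
- rewrite !(tmapE ((nmul_bilin A).2 _) ((nmul_bilin B).2 _)) nmulPl.
  exact: (tens_bilin A B).2.
- by rewrite !(linD (tl _ _)) ihy ihz scalerDr addrACA.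
Qed.

Lemma tens_mulE a b a' b' :
  tens_mul (a ⊗ b) (a' ⊗ b') = (a ** a') ⊗ (b ** b').
Proof.
rewrite /tens_mul (tliftE (tens_mul_bil _)).
exact: tmapE ((nmul_bilin A).2 _) ((nmul_bilin B).2 _) _ _.
Qed.

Fact tens_mulPl k b x y :
  tens_mul (k *: x + y) b = k *: tens_mul x b + tens_mul y b.
Proof. exact: tlift_linear (tens_mul_bil b) k x y. Qed.

Fact tens_mulPr k a x y :
  tens_mul a (k *: x + y) = k *: tens_mul a x + tens_mul a y.
Proof.
have l z := tlift_linear (tens_mul_bil z).
elim/tens_ind: a => [|a b|a b iha ihb].
- by rewrite /tens_mul !(lin0 (l _)) scaler0 addr0.
- by rewrite /tens_mul !(tliftE (tens_mul_bil _)) tl.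
- by move: iha ihb; rewrite /tens_mul !(linD (l _)) => -> ->; rewrite scalerDr addrACA.
Qed.

Fact tens_mulA : associative tens_mul.
Proof.
have ll b : linear (tens_mul^~ b) by move=> k x y; apply: tens_mulPl.
have lr a : linear (tens_mul a) by move=> k x y; apply: tens_mulPr.
have llD b x y : tens_mul (x + y) b = tens_mul x b + tens_mul y b.
  exact: (linD (ll b)).
have ll0 b : tens_mul 0 b = 0 by exact: (lin0 (ll b)).
elim/tens_ind=> [|a b|x x' ih ih'] y z; first by rewrite !ll0.
- elim/tens_ind: y => [|a' b'|y y' ih ih']; first by rewrite ll0 !(lin0 (lr _)) ll0.
  + elim/tens_ind: z => [|a'' b''|z z' ih ih']; first by rewrite !(lin0 (lr _)).
    * by rewrite !tens_mulE !nmulA.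
    * by rewrite !(linD (lr _)) ih ih'.
  + by rewrite llD !(linD (lr _)) llD ih ih'.
- by rewrite !llD ih ih'.
Qed.

HB.instance Definition _ :=
  Lmodule_isNAlgebra.Build K (tensor A B) tens_mulA tens_mulPl tens_mulPr.
End TensorAlgebra.

Lemma tensM (K : fieldType) (A B : nalgType K) (a a' : A) (b b' : B) :
  (a ⊗ b) ** (a' ⊗ b') = (a ** a') ⊗ (b ** b').
Proof. exact: tens_mulE. Qed.

Record multiplier (K : fieldType) (A : nalgType K) := Multiplier {
  mulL : A -> A;
  mulR : A -> A;
  mulL_linear : linear mulL;
  mulR_linear : linear mulR;
  mulL_mul : forall a b, mulL (a ** b) = mulL a ** b;
  mulR_mul : forall a b, mulR (a ** b) = a ** mulR b;
  mulRL : forall a b, mulR a ** b = a ** mulL b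
}.

Section MultiplierAlgebra.
Variables (K : fieldType) (A : nalgType K).
Notation M := (multiplier A).

HB.instance Definition _ := gen_eqMixin M.
HB.instance Definition _ := gen_choiceMixin M.

Lemma multP (x y : M) : mulL x =1 mulL y -> mulR x =1 mulR y -> x = y.
Proof.
case: x => L R h1 h2 h3 h4 h5; case: y => L' R' h1' h2' h3' h4' h5' /=.
move=> /funext eL /funext eR; subst L' R'.
by congr Multiplier; apply: Prop_irrelevance.
Qed.

Let al b := (nmul_bilin A).1 b.
Let ar a := (nmul_bilin A).2 a.
Program Definition mult0 : M := @Multiplier K A (fun=> 0) (fun=> 0) _ _ _ _ _.
Next Obligation. by move=> k x y /=; rewrite scaler0 addr0. Qed.
Next Obligation. by move=> k x y /=; rewrite scaler0 addr0. Qed.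
Next Obligation. by move=> a b /=; rewrite nmul0l. Qed.
Next Obligation. by move=> a b /=; rewrite nmul0r. Qed.
Next Obligation. by move=> a b /=; rewrite nmul0r nmul0l. Qed.

Program Definition mult_add (x y : M) : M := @Multiplier K A
  (fun a => mulL x a + mulL y a) (fun a => mulR x a + mulR y a) _ _ _ _ _.
Next Obligation. by move=> x y k a b /=; rewrite !mulL_linear scalerDr addrACA. Qed.
Next Obligation. by move=> x y k a b /=; rewrite !mulR_linear scalerDr addrACA. Qed.
Next Obligation. by move=> x y a b /=; rewrite !mulL_mul nmulDl. Qed.
Next Obligation. by move=> x y a b /=; rewrite !mulR_mul nmulDr. Qed.
Next Obligation. by move=> x y a b /=; rewrite nmulDl nmulDr !mulRL. Qed.

Program Definition mult_scale (k : K) (x : M) : M := @Multiplier K A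
  (fun a => k *: mulL x a) (fun a => k *: mulR x a) _ _ _ _ _.
Next Obligation.
by move=> k x l a b /=; rewrite !mulL_linear scalerDr !scalerA mulrC.
Qed.
Next Obligation.
by move=> k x l a b /=; rewrite !mulR_linear scalerDr !scalerA mulrC.
Qed.
Next Obligation. by move=> k x a b /=; rewrite !mulL_mul nmulZl. Qed.
Next Obligation. by move=> k x a b /=; rewrite !mulR_mul nmulZr. Qed.
Next Obligation. by move=> k x a b /=; rewrite nmulZl nmulZr !mulRL. Qed.

Definition mult_opp (x : M) : M := mult_scale (-1) x.

Fact mult_addA : associative mult_add.
Proof. by move=> x y z; apply: multP => a /=; rewrite addrA. Qed.
Fact mult_addC : commutative mult_add.
Proof. by move=> x y; apply: multP => a /=; rewrite addrC. Qed.
Fact mult_add0 : left_id mult0 mult_add.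
Proof. by move=> x; apply: multP => a /=; rewrite add0r. Qed.
Fact mult_addN : left_inverse mult0 mult_opp mult_add.
Proof. by move=> x; apply: multP => a /=; rewrite scaleN1r addNr. Qed.
HB.instance Definition _ :=
  GRing.isZmodule.Build M mult_addA mult_addC mult_add0 mult_addN.

Fact mult_scaleA k l x : mult_scale k (mult_scale l x) = mult_scale (k * l) x.
Proof. by apply: multP => a /=; rewrite scalerA. Qed.
Fact mult_scale1 : left_id 1 mult_scale.
Proof. by move=> x; apply: multP => a /=; rewrite scale1r. Qed.
Fact mult_scaleDr : right_distributive mult_scale +%R.
Proof. by move=> k x y; apply: multP => a /=; rewrite scalerDr. Qed.
Fact mult_scaleDl x : {morph mult_scale^~ x : k l / k + l}.
Proof. by move=> k l; apply: multP => a /=; rewrite scalerDl. Qed.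
HB.instance Definition _ := GRing.Zmodule_isLmodule.Build K M
  mult_scaleA mult_scale1 mult_scaleDr mult_scaleDl.

(* (xy)a = x(ya) and a(xy) = (ax)y *)
Program Definition mult_mul (x y : M) : M := @Multiplier K A
  (fun a => mulL x (mulL y a)) (fun a => mulR y (mulR x a)) _ _ _ _ _.
Next Obligation. by move=> x y k a b /=; rewrite !mulL_linear. Qed.
Next Obligation. by move=> x y k a b /=; rewrite !mulR_linear. Qed.
Next Obligation. by move=> x y a b /=; rewrite !mulL_mul. Qed.
Next Obligation. by move=> x y a b /=; rewrite !mulR_mul. Qed.
Next Obligation. by move=> x y a b /=; rewrite !mulRL. Qed.

Lemma mulLP k x y a : mulL (k *: x + y) a = k *: mulL x a + mulL y a.
Proof. by []. Qed.
Lemma mulRP k x y a : mulR (k *: x + y) a = k *: mulR x a + mulR y a.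
Proof. by []. Qed.

Fact mult_mulA : associative mult_mul.
Proof. by move=> x y z; apply: multP. Qed.
Fact mult_mulPl k b x y :
  mult_mul (k *: x + y) b = k *: mult_mul x b + mult_mul y b.
Proof. by apply: multP => a //=; rewrite mulR_linear. Qed.
Fact mult_mulPr k a x y :
  mult_mul a (k *: x + y) = k *: mult_mul a x + mult_mul a y.
Proof. by apply: multP => b //=; rewrite mulL_linear. Qed.
HB.instance Definition _ :=
  Lmodule_isNAlgebra.Build K M mult_mulA mult_mulPl mult_mulPr.

Program Definition mult1 : M := @Multiplier K A id id _ _ _ _ _.
Next Obligation. by []. Qed.
Next Obligation. by []. Qed.
Next Obligation. by []. Qed.
Next Obligation. by []. Qed.
Next Obligation. by []. Qed.

(* The canonical homomorphism A -> M(A), injective when the product of A is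
   nondegenerate. *)
Program Definition memb (c : A) : M :=
  @Multiplier K A (nmul c) (nmul^~ c) _ _ _ _ _.
Next Obligation. by move=> c; apply: ar. Qed.
Next Obligation. by move=> c; apply: al. Qed.
Next Obligation. by move=> c a b /=; rewrite nmulA. Qed.
Next Obligation. by move=> c a b /=; rewrite nmulA. Qed.
Next Obligation. by move=> c a b /=; rewrite nmulA. Qed.

Lemma memb_hom : is_alg_hom memb.
Proof.
split=> [k x y|x y]; apply: multP => a /=; rewrite ?nmulPl ?nmulPr //.
- by rewrite nmulA.
- by rewrite nmulA.
Qed.

Lemma memb_inj : nondegenerate_mul A -> injective memb.
Proof.
move=> [_ nd] x y e; apply/eqP; rewrite -subr_eq0; apply/eqP/nd => b.
have := congr1 (fun m => mulL m b) e => /= exy.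
by rewrite -scaleN1r addrC nmulPl exy scaleN1r addNr.
Qed.
End MultiplierAlgebra.

Section TensorMultiplier.
Variables (K : fieldType) (A B : nalgType K).

(* The image in M(A ⊗ B) of the elementary tensor x ⊗ y of M(A) ⊗ M(B). *)
Program Definition mtens (x : multiplier A) (y : multiplier B) :
    multiplier (tensor A B) :=
  @Multiplier K (tensor A B)
    (tmap (mulL x) (mulL y)) (tmap (mulR x) (mulR y)) _ _ _ _ _.
Next Obligation. by move=> x y; apply: tmap_linear; apply: mulL_linear. Qed.
Next Obligation. by move=> x y; apply: tmap_linear; apply: mulR_linear. Qed.
Next Obligation.
move=> x y a b; have l := tmap_linear (mulL_linear x) (mulL_linear y).
elim/tens_ind: a => [|a a'|a a' ih ih']; first by rewrite !(nmul0l, lin0 l).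
- elim/tens_ind: b => [|b b'|b b' ih ih']; first by rewrite !nmul0r lin0.
  + by rewrite !tensM !(tmapE (mulL_linear x) (mulL_linear y)) tensM !mulL_mul.
  + by rewrite !nmulDr !(linD l) ih ih'.
- by rewrite !(nmulDl, linD l) ih ih'.
Qed.
Next Obligation.
move=> x y a b; have l := tmap_linear (mulR_linear x) (mulR_linear y).
elim/tens_ind: a => [|a a'|a a' ih ih']; first by rewrite !nmul0l !lin0.
- elim/tens_ind: b => [|b b'|b b' ih ih'].
  + by rewrite nmul0r (lin0 l) nmul0r.
  + by rewrite !tensM !(tmapE (mulR_linear x) (mulR_linear y)) tensM !mulR_mul.
  + by rewrite !(nmulDr, linD l) ih ih'.
- by rewrite !nmulDl !(linD l) ih ih'.
Qed.
Next Obligation.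
move=> x y a b; have l := tmap_linear (mulR_linear x) (mulR_linear y).
have l' := tmap_linear (mulL_linear x) (mulL_linear y).
elim/tens_ind: a => [|a a'|a a' ih ih']; first by rewrite !(lin0 l) !nmul0l.
- elim/tens_ind: b => [|b b'|b b' ih ih'].
  + by rewrite (lin0 l') !nmul0r.
  + rewrite (tmapE (mulR_linear x) (mulR_linear y)).
    by rewrite (tmapE (mulL_linear x) (mulL_linear y)) !tensM !mulRL.
  + by rewrite (linD l') !nmulDr ih ih'.
- by rewrite (linD l) !nmulDl ih ih'.
Qed.

Lemma mulL_mtens x y a b : mulL (mtens x y) (a ⊗ b) = mulL x a ⊗ mulL y b.
Proof. exact: (tmapE (mulL_linear x) (mulL_linear y)). Qed.
Lemma mulR_mtens x y a b : mulR (mtens x y) (a ⊗ b) = mulR x a ⊗ mulR y b.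
Proof. exact: (tmapE (mulR_linear x) (mulR_linear y)). Qed.

Lemma mtens_bilin : bilin mtens.
Proof.
have [tl tr] := tens_bilin A B.
split=> [y|x] k u v; apply: multP; apply: tlift_unique.
all: try by apply: mulL_linear.
all: try by apply: mulR_linear.
all: move=> a b; rewrite ?(mulLP, mulRP) !(mulL_mtens, mulR_mtens) ?(mulLP, mulRP).
all: by rewrite ?(tl _ k) ?(tr _ k).
Qed.

Lemma memb_tens (a : A) (b : B) : memb (a ⊗ b) = mtens (memb a) (memb b).
Proof.
apply: multP; apply: tlift_unique.
all: try by apply: mulL_linear.
all: try by apply: mulR_linear.
all: by move=> c d; rewrite (mulL_mtens, mulR_mtens) /= tensM.
Qed.
End TensorMultiplier.

Section Associator.
Variables (K : fieldType) (A B C : nalgType K).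

Definition tassoc : tensor (tensor A B) C -> tensor A (tensor B C) :=
  tlift (fun t c => tlift (fun a b => a ⊗ (b ⊗ c)) t).

Definition tassocV : tensor A (tensor B C) -> tensor (tensor A B) C :=
  tlift (fun a t => tlift (fun b c => (a ⊗ b) ⊗ c) t).

Let b1 (c : C) : bilin (fun (a : A) (b : B) => a ⊗ (b ⊗ c)).
Proof.
split=> [b|a] k x y /=; first exact: (tens_bilin _ _).1.
by rewrite ((tens_bilin _ _).1 c k x y); apply: (tens_bilin _ _).2.
Qed.

Let b1V (a : A) : bilin (fun (b : B) (c : C) => (a ⊗ b) ⊗ c).
Proof.
split=> [c|b] k x y /=; last exact: (tens_bilin _ _).2.
by rewrite ((tens_bilin _ _).2 a k x y); apply: (tens_bilin _ _).1.
Qed.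

Let b2 : bilin (fun (t : tensor A B) (c : C) =>
  tlift (fun a b => a ⊗ (b ⊗ c)) t).
Proof.
have l c := tlift_linear (b1 c).
split=> [c|t]; first exact: l.
move=> k x y /=; elim/tens_ind: t => [|a b|t t' ih ih'].
- by rewrite !(lin0 (l _)) scaler0 addr0.
- rewrite !(tliftE (b1 _)) ((tens_bilin _ _).2 b k x y).
  exact: (tens_bilin _ _).2.
- by rewrite !(linD (l _)) ih ih' scalerDr addrACA.
Qed.

Let b2V : bilin (fun (a : A) (t : tensor B C) =>
  tlift (fun b c => (a ⊗ b) ⊗ c) t).
Proof.
have l a := tlift_linear (b1V a).
split=> [t|a]; last exact: l.
move=> k x y /=; elim/tens_ind: t => [|b c|t t' ih ih'].
- by rewrite !(lin0 (l _)) scaler0 addr0.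
- rewrite !(tliftE (b1V _)) ((tens_bilin _ _).1 b k x y).
  exact: (tens_bilin _ _).1.
- by rewrite !(linD (l _)) ih ih' scalerDr addrACA.
Qed.

Lemma tassocE a b c : tassoc ((a ⊗ b) ⊗ c) = a ⊗ (b ⊗ c).
Proof. by rewrite /tassoc (tliftE b2) (tliftE (b1 _)). Qed.

Lemma tassocVE a b c : tassocV (a ⊗ (b ⊗ c)) = (a ⊗ b) ⊗ c.
Proof. by rewrite /tassocV (tliftE b2V) (tliftE (b1V _)). Qed.

Lemma tassoc_linear : linear tassoc. Proof. exact: tlift_linear b2. Qed.
Lemma tassocV_linear : linear tassocV. Proof. exact: tlift_linear b2V. Qed.

Lemma tens3_ind (P : tensor (tensor A B) C -> Prop) :
  P 0 -> (forall a b c, P ((a ⊗ b) ⊗ c)) ->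
  (forall x y, P x -> P y -> P (x + y)) -> forall x, P x.
Proof.
move=> P0 Pt PD; apply: tens_ind => // t c; elim/tens_ind: t => // [|x y hx hy].
- suff -> : (0 : tensor A B) ⊗ c = 0 by [].
  exact: (lin0 ((tens_bilin _ _).1 c)).
- have -> : (x + y) ⊗ c = x ⊗ c + y ⊗ c.
    exact: (linD ((tens_bilin _ _).1 c)).
  exact: PD.
Qed.

Lemma tassocK : cancel tassoc tassocV.
Proof.
have [l lV] := (tassoc_linear, tassocV_linear).
apply: tens3_ind => [|a b c|x y hx hy]; first by rewrite !lin0.
- by rewrite tassocE tassocVE.
- by rewrite (linD l) (linD lV) hx hy.
Qed.

Lemma tassocVK : cancel tassocV tassoc.
Proof.
have [l lV] := (tassoc_linear, tassocV_linear).
apply: tens_ind => [|a t|x y hx hy]; first by rewrite !lin0.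
- elim/tens_ind: t => [|b c|x y hx hy].
  + suff -> : a ⊗ (0 : tensor B C) = 0 by rewrite !lin0.
    exact: (lin0 ((tens_bilin _ _).2 a)).
  + by rewrite tassocVE tassocE.
  + suff -> : a ⊗ (x + y) = a ⊗ x + a ⊗ y by rewrite (linD lV) (linD l) hx hy.
    exact: (linD ((tens_bilin _ _).2 a)).
- by rewrite (linD lV) (linD l) hx hy.
Qed.

Lemma tassoc_hom : is_alg_hom tassoc.
Proof.
have l := tassoc_linear; split=> // x y.
elim/tens3_ind: x => [|a b c|x x' hx hx'].
- by rewrite nmul0l !(lin0 l) nmul0l.
- elim/tens3_ind: y => [|a' b' c'|y y' hy hy'].
  + by rewrite nmul0r !(lin0 l) nmul0r.
  + by rewrite !tensM !tassocE !tensM.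
  + by rewrite nmulDr !(linD l) nmulDr hy hy'.
- by rewrite nmulDl !(linD l) nmulDl hx hx'.
Qed.

Lemma tassocV_mul : {morph tassocV : x y / x ** y}.
Proof.
move=> x y; apply: (can_inj tassocK); rewrite tassoc_hom.2.
by rewrite !tassocVK.
Qed.

(* M((A ⊗ B) ⊗ C) = M(A ⊗ (B ⊗ C)) *)
Program Definition massoc (x : multiplier (tensor (tensor A B) C)) :
    multiplier (tensor A (tensor B C)) :=
  @Multiplier K (tensor A (tensor B C))
    (fun t => tassoc (mulL x (tassocV t)))
    (fun t => tassoc (mulR x (tassocV t))) _ _ _ _ _.
Next Obligation.
by move=> x k t u /=; rewrite tassocV_linear mulL_linear tassoc_linear.
Qed.
Next Obligation.
by move=> x k t u /=; rewrite tassocV_linear mulR_linear tassoc_linear.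
Qed.
Next Obligation.
by move=> x t u /=; rewrite tassocV_mul mulL_mul tassoc_hom.2 tassocVK.
Qed.
Next Obligation.
by move=> x t u /=; rewrite tassocV_mul mulR_mul tassoc_hom.2 tassocVK.
Qed.
Next Obligation.
move=> x t u; rewrite -{1}(tassocVK u) -tassoc_hom.2 mulRL.
by rewrite tassoc_hom.2 tassocVK.
Qed.
End Associator.

Local Open Scope group_scope.

Section PiCoalgebra.
Variables (K : fieldType) (pi : groupType) (A : pi -> nalgType K).

(* The identification of the components indexed by two equal elements. *)
Definition castA (x y : pi) (e : x = y) : A x -> A y :=
  fun a => ecast z (A z) e a.

(* In the antipode axioms, S_{α^-1} takes its values in A_{(α^-1)^-1} = A_α. *)
Record hopf_pi_coalgebra
    (one : forall α, A α)
    (Δ : forall α β, A (α * β) -> tensor (A α) (A β))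
    (ε : A 1 -> K)
    (S : forall α, A α -> A α^-1) : Prop := HopfPiCoalgebra {
  hopf_one : forall α, is_unit (one α);
  hopf_comul_hom : forall α β, is_alg_hom (@Δ α β);
  hopf_comul_one : forall α β, Δ α β (one (α * β)) = one α ⊗ one β;
  hopf_counit_linear : scalar ε;
  hopf_counit_mul : forall a b, ε (a ** b) = (ε a * ε b)%R;
  (* The guard only matters when A_1 = 0, in which case every component is the
     zero algebra; there no linear map A_1 -> K can preserve the unit. *)
  hopf_counit_one : one 1 <> 0%R -> ε (one 1) = 1%R;
  hopf_antipode_linear : forall α, linear (@S α);
  hopf_coassoc : forall α β γ (a : A (α * β * γ)),
    tassoc (tmap (@Δ α β) id (Δ (α * β) γ a)) =
    tmap id (@Δ β γ) (Δ α (β * γ) (castA (esym (mulgA α β γ)) a));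
  hopf_counit_r : forall α (a : A (α * 1)),
    tlift (fun (x : A α) (y : A 1) => (ε y *: x)%R) (Δ α 1 a) =
    castA (mulg1 α) a;
  hopf_counit_l : forall α (a : A (1 * α)),
    tlift (fun (x : A 1) (y : A α) => (ε x *: y)%R) (Δ 1 α a) =
    castA (mul1g α) a;
  hopf_antipode_l : forall α (a : A (α^-1 * α)),
    tlift (fun (x : A α^-1) (y : A α) => castA (invgK α) (S α^-1 x) ** y)
      (Δ α^-1 α a) =
    (ε (castA (mulVg α) a) *: one α)%R;
  hopf_antipode_r : forall α (a : A (α * α^-1)),
    tlift (fun (x : A α) (y : A α^-1) => x ** castA (invgK α) (S α^-1 y))
      (Δ α α^-1 a) =
    (ε (castA (mulgV α) a) *: one α)%R
}.

Section MultiplierHopf.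
Variable Δ : forall α β, A (α * β) -> multiplier (tensor (A α) (A β)).

(* The extension Δ_{α,β} ⊗ I : A_{αβ} ⊗ A_γ -> M((A_α ⊗ A_β) ⊗ A_γ). *)
Definition comul_id α β γ :
    tensor (A (α * β)) (A γ) -> multiplier (tensor (tensor (A α) (A β)) (A γ)) :=
  tlift (fun x c => mtens (Δ x) (memb c)).

(* The extension I ⊗ Δ_{β,γ} : A_α ⊗ A_{βγ} -> M(A_α ⊗ (A_β ⊗ A_γ)). *)
Definition id_comul α β γ :
    tensor (A α) (A (β * γ)) -> multiplier (tensor (A α) (tensor (A β) (A γ))) :=
  tlift (fun a x => mtens (memb a) (Δ x)).

Lemma comul_idE α β γ (x : A (α * β)) (c : A γ) :
  is_alg_hom (@Δ α β) -> comul_id (x ⊗ c) = mtens (Δ x) (memb c).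
Proof.
move=> [lD _]; apply: (tliftE (f := fun x c => mtens (Δ x) (memb c))).
have [tl tr] := mtens_bilin (tensor (A α) (A β)) (A γ).
by split=> [y|y] k u v /=; rewrite ?lD ?(memb_hom _).1 ?(tl _ k) ?(tr _ k).
Qed.

Lemma id_comulE α β γ (a : A α) (x : A (β * γ)) :
  is_alg_hom (@Δ β γ) -> id_comul (a ⊗ x) = mtens (memb a) (Δ x).
Proof.
move=> [lD _]; apply: (tliftE (f := fun a x => mtens (memb a) (Δ x))).
have [tl tr] := mtens_bilin (A α) (tensor (A β) (A γ)).
by split=> [y|y] k u v /=; rewrite ?lD ?(memb_hom _).1 ?(tl _ k) ?(tr _ k).
Qed.

(* An element of M(A_α ⊗ A_β) lies in A_α ⊗ A_β when it is in the image of
   memb. In mhopf_coassoc, t and s are Δ_{αβ,γ}(b)(1 ⊗ c) and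
   (a ⊗ 1)Δ_{α,βγ}(b) as elements of A_{αβ} ⊗ A_γ and A_α ⊗ A_{βγ}; they exist
   by mhopf_cov1 and mhopf_cov2. In mhopf_bij1 and mhopf_bij2, T is the map
   T^1_{α,β}, resp. T^2_{α,β}, determined by its values on elementary tensors. *)
Record multiplier_hopf_pi_coalgebra : Prop := MultiplierHopfPiCoalgebra {
  mhopf_hom : forall α β, is_alg_hom (@Δ α β);
  mhopf_cov1 : forall α β (a : A (α * β)) (b : A β),
    exists t, Δ a ** mtens (mult1 (A α)) (memb b) = memb t;
  mhopf_cov2 : forall α β (a : A α) (b : A (α * β)),
    exists t, mtens (memb a) (mult1 (A β)) ** Δ b = memb t;
  mhopf_coassoc : forall α β γ (a : A α) (b : A (α * β * γ)) (c : A γ)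
      (t : tensor (A (α * β)) (A γ)) (s : tensor (A α) (A (β * γ))),
    memb t = Δ b ** mtens (mult1 (A (α * β))) (memb c) ->
    memb s = mtens (memb a) (mult1 (A (β * γ))) **
             Δ (castA (esym (mulgA α β γ)) b) ->
    massoc (mtens (mtens (memb a) (mult1 (A β))) (mult1 (A γ)) ** comul_id t) =
    id_comul s ** mtens (mult1 (A α)) (mtens (mult1 (A β)) (memb c));
  mhopf_bij1 : forall α β,
    exists T : tensor (A (α * β)) (A β) -> tensor (A α) (A β),
    [/\ linear T,
        forall a b, memb (T (a ⊗ b)) = Δ a ** mtens (mult1 (A α)) (memb b)
      & bijective T];
  mhopf_bij2 : forall α β,
    exists T : tensor (A α) (A (α * β)) -> tensor (A α) (A β),
    [/\ linear T,
        forall a b, memb (T (a ⊗ b)) = mtens (memb a) (mult1 (A β)) ** Δ b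
      & bijective T]
}.
End MultiplierHopf.
End PiCoalgebra.

(* Main.v *)
Require Import Defs.
From mathcomp Require Import all_boot all_order all_algebra.
From mathcomp Require Import reals complex.
From mathcomp Require Import boolp classical_sets.
Set Implicit Arguments.
Unset Strict Implicit.
Unset Printing Implicit Defensive.
Import GRing.Theory.
Local Open Scope ring_scope.

(* If A is a Hopf π-coalgebra, then T^1_{α,β} has inverse
   a ⊗ b |-> a_(1) ⊗ S(a_(2)) b, with a_(1) ⊗ a_(2) = Δ_{αβ,β^-1}(a), and
   symmetrically for T^2.

   Conversely, coassociativity says that T^2 ⊗ I and I ⊗ T^1 commute. Applied to
   the preimage of 1 ⊗ x ⊗ 1 with x in A_1, this gives
   1_α ⊗ m(T^1)^-1(x ⊗ 1_β) = m(T^2)^-1(1_α ⊗ x) ⊗ 1_β, so that both elements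
   are the same scalar ε(x), which defines the counit. Then
   S(x) = (ε ⊗ I)(T^1)^-1(x ⊗ 1) satisfies the left antipode axiom,
   S'(x) = (I ⊗ ε)(T^2)^-1(1 ⊗ x) the right one, and S = S' by the same argument
   applied to 1 ⊗ x ⊗ 1 with x in A_{α^-1}. *)

(** * Linear functionals on a vector space *)

(* Project onto the line of v along a maximal subspace that avoids v. *)
Lemma linear_functional (K : fieldType) (V : lmodType K) (v : V) :
  v != 0 -> exists2 f : V -> K, scalar f & f v = 1.
Proof.
move=> v0.
pose P (X : set V) := (forall k x y, X x -> X y -> X (k *: x + y)) /\ ~ X v.
have [F FP tot|H [[Hl Hv] maxH]] := @Zorn_bigcup V P.
  split=> [k x y [X FX Xx] [Y FY Yy]|[X /FP [_ nXv] /nXv]//].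
  have [XY|YX] := tot X Y FX FY.
    by exists Y => //; apply: (FP Y FY).1 => //; apply: XY.
  by exists X => //; apply: (FP X FX).1 => //; apply: YX.
(* [P] admits the empty set, so [H 0] comes from maximality: otherwise adding 0 to [H] would give a
   larger set satisfying [P]. *)
have H0 : H 0.
  apply: contrapT => nH0.
  have HZ k x : H x -> H (k *: x).
    move=> Hx; have := Hl (k - 1) x x Hx Hx.
    by rewrite -[X in _ + X]scale1r -scalerDl subrK.
  apply: (maxH [set x | H x \/ x = 0]%classic); last split.
  - by split=> [x Hx|/(_ 0 (or_intror erefl))//]; left.
  - move=> k x y [Hx|->] [Hy|->].
    + by left; apply: Hl.
    + by left; rewrite addr0; apply: HZ.
    + by left; rewrite scaler0 add0r.
    + by right; rewrite scaler0 addr0.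
  - by case=> // ve; rewrite ve eqxx in v0.
have HZ k x : H x -> H (k *: x) by move=> Hx; rewrite -[_ *: _]addr0; apply: Hl.
have HB x y : H x -> H y -> H (x - y).
  by move=> Hx Hy; rewrite addrC -scaleN1r; apply: Hl.
have dec w : exists k, H (w - k *: v).
  have [Hw|nHw] := pselect (H w); first by exists 0; rewrite scale0r subr0.
  (* The strictly larger subspace [H] + K w has to contain v. If v - c w lies in [H], then c ≠ 0
     because v is not in [H], and so w - c^-1 v lies in [H]. *)
  apply: contrapT => nk.
  apply: (maxH [set x | exists c, H (x - c *: w)]%classic); last split.
  - split=> [x Hx|/(_ w)]; first by exists 0; rewrite scale0r subr0.
    by move=> h; apply/nHw/h; exists 1; rewrite scale1r subrr.
  - move=> k x y [c Hc] [d Hd]; exists (k * c + d).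
    rewrite scalerDl -scalerA opprD addrACA -scalerN -scalerDr.
    exact: Hl.
  - case=> c Hc; have [c0|c0] := eqVneq c 0.
      by apply: Hv; move: Hc; rewrite c0 scale0r subr0.
    apply: nk; exists c^-1; have := HZ (- c^-1) _ Hc.
    by rewrite scalerBr !scaleNr opprK scalerA mulVf // scale1r addrC.
pose f w := projT1 (cid (dec w)).
have fP w : H (w - f w *: v) by apply: (projT2 (cid (dec w))).
(* The coefficient is unique: a second one would put a nonzero multiple of v into [H]. *)
have fE w k : H (w - k *: v) -> f w = k.
  move=> Hk; apply/eqP; rewrite -subr_eq0; apply/negPn/negP => d0.
  apply: Hv; have := HZ (f w - k)^-1 _ (HB _ _ Hk (fP w)).
  rewrite [_ - (w - _)]addrC opprB addrA subrK -scalerBl.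
  by rewrite scalerA mulVf // scale1r.
exists f; last by apply: fE; rewrite scale1r subrr.
move=> k x y; apply: fE; rewrite scalerDl -scalerA opprD addrACA -scalerN -scalerDr.
exact: Hl.
Qed.

(** * Linear maps on tensor products: multiplication, contractions and Galois maps *)

Section TensorMaps.
Variable K : fieldType.

Lemma lin_id (V : lmodType K) : linear (@id V). Proof. by []. Qed.

Lemma lin_comp (U V W : lmodType K) (f : V -> W) (g : U -> V) :
  linear f -> linear g -> linear (f \o g).
Proof. by move=> lf lg k x y /=; rewrite lg lf. Qed.

Lemma lin_nmull (A : nalgType K) (a : A) : linear (nmul a).
Proof. exact: (nmul_bilin A).2. Qed.

Lemma lin_nmulr (A : nalgType K) (b : A) : linear (nmul^~ b).
Proof. exact: (nmul_bilin A).1. Qed.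

Lemma lin_tensl (A B : lmodType K) (a : A) : linear (@tens K A B a).
Proof. exact: (tens_bilin A B).2. Qed.

Lemma lin_tensr (A B : lmodType K) (b : B) : linear ((@tens K A B)^~ b).
Proof. exact: (tens_bilin A B).1. Qed.

Lemma tensZl (A B : lmodType K) k (a : A) (b : B) : (k *: a) ⊗ b = k *: (a ⊗ b).
Proof. exact: (linZ (lin_tensr b)). Qed.

Lemma tensZr (A B : lmodType K) k (a : A) (b : B) : a ⊗ (k *: b) = k *: (a ⊗ b).
Proof. exact: (linZ (lin_tensl a)). Qed.

Lemma can_linear (V W : lmodType K) (f : V -> W) (g : W -> V) :
  linear f -> cancel f g -> cancel g f -> linear g.
Proof. by move=> lf fK gK k x y; apply: (can_inj fK); rewrite lf !gK. Qed.

Definition tmul (A : nalgType K) : tensor A A -> A := tlift (@nmul K A).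

Lemma tmulE (A : nalgType K) (a b : A) : tmul (a ⊗ b) = a ** b.
Proof. exact: tliftE (nmul_bilin A) a b. Qed.

Lemma tmul_linear (A : nalgType K) : linear (@tmul A).
Proof. exact: tlift_linear (nmul_bilin A). Qed.

(* ε ⊗ id and id ⊗ ε, after the identifications K ⊗ B = B and A ⊗ K = A *)
Definition contractl (A B : lmodType K) (ε : A -> K) : tensor A B -> B :=
  tlift (fun a b => ε a *: b).
Definition contractr (A B : lmodType K) (ε : B -> K) : tensor A B -> A :=
  tlift (fun a b => ε b *: a).

Section Contract.
Variables (A B : lmodType K).

Lemma contractl_bilin (ε : A -> K) : scalar ε -> bilin (fun a (b : B) => ε a *: b).
Proof.
move=> lε; split=> [b|a] k x y /=; first by rewrite lε scalerDl scalerA.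
by rewrite scalerDr !scalerA mulrC.
Qed.

Lemma contractr_bilin (ε : B -> K) : scalar ε -> bilin (fun (a : A) b => ε b *: a).
Proof.
move=> lε; split=> [b|a] k x y /=; last by rewrite lε scalerDl scalerA.
by rewrite scalerDr !scalerA mulrC.
Qed.

Lemma contractlE (ε : A -> K) a (b : B) : scalar ε -> contractl ε (a ⊗ b) = ε a *: b.
Proof. by move=> /contractl_bilin bε; apply: tliftE bε _ _. Qed.

Lemma contractrE (ε : B -> K) (a : A) b : scalar ε -> contractr ε (a ⊗ b) = ε b *: a.
Proof. by move=> /contractr_bilin bε; apply: tliftE bε _ _. Qed.

Lemma contractl_linear (ε : A -> K) : scalar ε -> linear (@contractl A B ε).
Proof. by move=> /contractl_bilin; apply: tlift_linear. Qed.

Lemma contractr_linear (ε : B -> K) : scalar ε -> linear (@contractr A B ε).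
Proof. by move=> /contractr_bilin; apply: tlift_linear. Qed.
End Contract.

Lemma tens3_unique (A B C : nalgType K) (V : lmodType K)
    (g h : tensor A (tensor B C) -> V) :
  linear g -> linear h -> (forall a b c, g (a ⊗ (b ⊗ c)) = h (a ⊗ (b ⊗ c))) ->
  g =1 h.
Proof.
move=> lg lh e; apply: tlift_unique => // a t.
apply: (tlift_unique (g := g \o tens a) (h := h \o tens a)) => [||b c];
  [exact: lin_comp lg (lin_tensl a)|exact: lin_comp lh (lin_tensl a)|exact: e].
Qed.
(* For D = Δ_{α,β}, galois1 and galois2 are T^1_{α,β} and T^2_{α,β}. *)
Section GaloisMaps.
Variables (A B C : nalgType K) (D : C -> tensor A B).

Definition galois1 : tensor C B -> tensor A B :=
  tmap id (@tmul B) \o @tassoc K A B B \o tmap D id.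

Definition galois2 : tensor A C -> tensor A B :=
  tmap (@tmul A) id \o @tassocV K A A B \o tmap id D.

Hypothesis linD : linear D.

Lemma galois1_linear : linear galois1.
Proof.
apply: lin_comp; last exact: tmap_linear.
by apply: lin_comp; [apply: tmap_linear; last exact: tmul_linear|exact: tassoc_linear].
Qed.

Lemma galois2_linear : linear galois2.
Proof.
apply: lin_comp; last exact: tmap_linear.
by apply: lin_comp; [apply: tmap_linear; first exact: tmul_linear|exact: tassocV_linear].
Qed.
End GaloisMaps.
End TensorMaps.

(** * Automatic linearity of maps composed from the standard ones *)

Ltac lin := repeat lazymatch goal with
  | |- GRing.linear_for _ (tmap _ _) => apply: tmap_linear
  | |- GRing.linear_for _ (@tassoc _ _ _ _) => exact: tassoc_linear
  | |- GRing.linear_for _ (@tassocV _ _ _ _) => exact: tassocV_linear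
  | |- GRing.linear_for _ (@tmul _ _) => exact: tmul_linear
  | |- GRing.linear_for _ (contractl _) => apply: contractl_linear
  | |- GRing.linear_for _ (contractr _) => apply: contractr_linear
  | |- GRing.linear_for _ (nmul _) => exact: lin_nmull
  | |- GRing.linear_for _ (fun x => x ** _) => exact: lin_nmulr
  | |- GRing.linear_for _ (tens _) => exact: lin_tensl
  | |- GRing.linear_for _ (fun x => x ⊗ _) => exact: lin_tensr
  | |- GRing.linear_for _ id => exact: lin_id
  | |- GRing.linear_for _ (fun x => x) => exact: lin_id
  | |- GRing.linear_for _ (_ \o _) => apply: lin_comp
  | |- GRing.linear_for _ (galois1 _) => apply: galois1_linear
  | |- GRing.linear_for _ (galois2 _) => apply: galois2_linear
  | |- GRing.linear_for _ _ =>
      first [assumption | match goal with H : forall _, _ |- _ => exact: H end]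
  end.
#[local] Hint Extern 0 (GRing.linear_for _ _) => solve [lin] : core.

(** * Composition of tensor maps, and multipliers of unital algebras *)

Section TensorMapTheory.
Variable K : fieldType.

Lemma tmap_comp (A A' A'' B B' B'' : lmodType K) (f : A -> A') (f' : A' -> A'')
    (g : B -> B') (g' : B' -> B'') :
  linear f -> linear f' -> linear g -> linear g' ->
  tmap f' g' \o tmap f g =1 tmap (f' \o f) (g' \o g).
Proof. by move=> lf lf' lg lg'; apply: tlift_unique => // a b; rewrite /= !tmapE. Qed.

Lemma tmap_id (A B : lmodType K) : tmap (@id A) (@id B) =1 id.
Proof. by apply: tlift_unique => // a b; rewrite tmapE. Qed.

Lemma tmap_can (A A' B B' : lmodType K) (f : A -> A') (f' : A' -> A)
    (g : B -> B') (g' : B' -> B) :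
  linear f -> linear f' -> linear g -> linear g' ->
  cancel f f' -> cancel g g' -> cancel (tmap f g) (tmap f' g').
Proof.
move=> lf lf' lg lg' fK gK.
apply: (tlift_unique (g := tmap f' g' \o tmap f g)) => // a b.
by rewrite /= !tmapE ?fK ?gK.
Qed.

Lemma tassoc_tmap (A A' B B' C C' : nalgType K)
    (f : A -> A') (g : B -> B') (h : C -> C') :
  linear f -> linear g -> linear h ->
  forall z, tassoc (tmap (tmap f g) h z) = tmap f (tmap g h) (tassoc z).
Proof.
move=> lf lg lh; have lfg := tmap_linear lf lg; have lgh := tmap_linear lg lh.
elim/tens3_ind=> [|a b c|x y hx hy].
- by rewrite !(lin0 (tmap_linear _ _), lin0 (@tassoc_linear _ _ _ _)).
- by rewrite !(tmapE, tassocE).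
- by rewrite !(linD (tmap_linear _ _), linD (@tassoc_linear _ _ _ _)) ?hx ?hy.
Qed.

Lemma is_unitL (A : nalgType K) (u a : A) : is_unit u -> u ** a = a.
Proof. by move=> /(_ a) []. Qed.
Lemma is_unitR (A : nalgType K) (u a : A) : is_unit u -> a ** u = a.
Proof. by move=> /(_ a) []. Qed.

Lemma is_unit_tens (A B : nalgType K) (u : A) (v : B) :
  is_unit u -> is_unit v -> is_unit (u ⊗ v).
Proof.
move=> hu hv z; split; move: z.
  apply: tlift_unique (lin_nmull _) (@lin_id _ _) _ => a b.
  by rewrite tensM !is_unitL.
apply: tlift_unique (lin_nmulr _) (@lin_id _ _) _ => a b.
by rewrite tensM !is_unitR.
Qed.

Lemma mult1_memb (A : nalgType K) (u : A) : is_unit u -> mult1 A = memb u.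
Proof.
by move=> hu; apply: multP => a; case: (hu a) => e1 e2; rewrite [RHS](e1, e2).
Qed.

(** L(a) = L(ua) = L(u)a and R(a) = R(a)u = aL(u), so the value L(u) determines the multiplier. This
    is M(A) = A for unital A. *)
Lemma memb_surj (A : nalgType K) (u : A) (m : multiplier A) :
  is_unit u -> m = memb (mulL m u).
Proof.
move=> hu; apply: multP => a /=; first by rewrite -mulL_mul is_unitL.
by rewrite -mulRL is_unitR.
Qed.

Lemma memb_unit_inj (A : nalgType K) (u : A) : is_unit u -> injective (@memb K A).
Proof.
by move=> hu x y /(congr1 (fun m => mulL m u)) /=; rewrite !is_unitR.
Qed.

(** The associator is an algebra isomorphism, so it conjugates multiplication by [z] to
    multiplication by [tassoc z]. *)
Lemma massoc_memb (A B C : nalgType K) (z : tensor (tensor A B) C) :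
  massoc (memb z) = memb (tassoc z).
Proof.
have h x y : tassoc (x ** y) = tassoc x ** tassoc y :> tensor A (tensor B C).
  exact: (tassoc_hom A B C).2.
apply: multP => t.
  by rewrite -[LHS]/(tassoc (z ** tassocV t)) h tassocVK.
by rewrite -[LHS]/(tassoc (tassocV t ** z)) h tassocVK.
Qed.
End TensorMapTheory.

(** * Module properties, commutation and inverses of the Galois maps *)

Section GaloisTheory.
Variable K : fieldType.

Section GaloisMaps.
Variables (A B C : nalgType K) (D : C -> tensor A B).
Hypothesis linD : linear D.

Lemma galois1E c b : galois1 D (c ⊗ b) = tmap id (nmul^~ b) (D c).
Proof.
rewrite /galois1 /= tmapE //.
apply: (tlift_unique (g := tmap id (@tmul K B) \o @tassoc K A B B \o
  (tens (B := B))^~ b)) => // x y.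
by rewrite /= tassocE !tmapE // tmulE.
Qed.

Lemma galois2E a c : galois2 D (a ⊗ c) = tmap (nmul a) id (D c).
Proof.
rewrite /galois2 /= tmapE //.
apply: (tlift_unique
  (g := tmap (@tmul K A) id \o @tassocV K A A B \o tens a)) => // x y.
by rewrite /= tassocVE !tmapE // tmulE.
Qed.
End GaloisMaps.

Section Unit.
Variables (A B C : nalgType K) (D : C -> tensor A B) (u : A) (v : B).
Hypotheses (lD : linear D) (hu : is_unit u) (hv : is_unit v).

Lemma galois1_mul c b : galois1 D (c ⊗ b) = D c ** (u ⊗ b).
Proof.
rewrite galois1E //; move: (D c).
apply: (tlift_unique (h := nmul^~ (u ⊗ b))) => // x y.
by rewrite tmapE // tensM (is_unitR _ hu).
Qed.

Lemma galois2_mul a c : galois2 D (a ⊗ c) = (a ⊗ v) ** D c.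
Proof.
rewrite galois2E //; move: (D c).
apply: (tlift_unique (h := nmul (a ⊗ v))) => // x y.
by rewrite tmapE // tensM (is_unitL _ hv).
Qed.

Lemma galois1_one c : galois1 D (c ⊗ v) = D c.
Proof. by rewrite galois1_mul is_unitR //; apply: is_unit_tens. Qed.

Lemma galois2_one c : galois2 D (u ⊗ c) = D c.
Proof. by rewrite galois2_mul is_unitL //; apply: is_unit_tens. Qed.
End Unit.

(** D(c)(1 ⊗ d)(1 ⊗ b) = D(c)(1 ⊗ db), so T^1 is right linear over [B]. The inverse of T^1 inherits
    this and is then known from its values on x ⊗ 1. *)
Lemma galois1_mulr (A B C : nalgType K) (D : C -> tensor A B) b :
  linear D -> galois1 D \o tmap id (nmul^~ b) =1 tmap id (nmul^~ b) \o galois1 D.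
Proof.
move=> lD; apply: tlift_unique => // c d.
rewrite /= tmapE // !galois1E //; move: (D c).
apply: (tlift_unique (h := tmap id (nmul^~ b) \o tmap id (nmul^~ d))) => // x y.
by rewrite /= !tmapE // nmulA.
Qed.

Lemma galois2_mull (A B C : nalgType K) (D : C -> tensor A B) a :
  linear D -> galois2 D \o tmap (nmul a) id =1 tmap (nmul a) id \o galois2 D.
Proof.
move=> lD; apply: tlift_unique => // c d.
rewrite /= tmapE // !galois2E //; move: (D d).
apply: (tlift_unique (h := tmap (nmul a) id \o tmap (nmul c) id)) => // x y.
by rewrite /= !tmapE // nmulA.
Qed.

(* Both sides send a ⊗ (b ⊗ c) to (a ⊗ 1) D b (1 ⊗ c). *)
Lemma galois_exchange (A B Q : nalgType K) (D : Q -> tensor A B)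
    (w : tensor A (tensor Q B)) : linear D ->
  tmap id (@tmul K B) (tassoc (tmap (galois2 D) id (tassocV w))) =
  tmap (@tmul K A) id (tassocV (tmap id (galois1 D) w)).
Proof.
move=> lD; move: w.
apply: (tens3_unique
  (g := tmap id (@tmul K B) \o @tassoc K _ _ _ \o tmap (galois2 D) id \o
        @tassocV K _ _ _)
  (h := tmap (@tmul K A) id \o @tassocV K _ _ _ \o tmap id (galois1 D))) => // a b c.
rewrite /= tassocVE !tmapE // galois1E // galois2E //; move: (D b).
apply: (tlift_unique
  (g := tmap id (@tmul K B) \o @tassoc K _ _ _ \o (tens (B := B))^~ c \o
        tmap (nmul a) id)
  (h := tmap (@tmul K A) id \o @tassocV K _ _ _ \o tens a \o
        tmap id (nmul^~ c))) => // x y.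
by rewrite /= !tmapE // tassocE tassocVE !tmapE // !tmulE.
Qed.

Section Coassociative.
Variables (A B C P Q R : nalgType K).
Variables (D1 : P -> tensor A B) (D2 : Q -> tensor P C).
Variables (D3 : R -> tensor B C) (D4 : Q -> tensor A R).
Hypotheses (l1 : linear D1) (l2 : linear D2) (l3 : linear D3) (l4 : linear D4).
Hypothesis coassoc : forall a,
  tassoc (tmap D1 id (D2 a)) = tmap id D3 (D4 a).

(** On a ⊗ (b ⊗ c) both sides take the iterated coproduct of b and multiply its first leg by a on
    the left and its last leg by c on the right. The two orders of iteration agree by [coassoc]. *)
Lemma galois_coassoc (w : tensor A (tensor Q C)) :
  tmap id (galois1 D3) (tassoc (tmap (galois2 D4) id (tassocV w))) =
  tassoc (tmap (galois2 D1) id (tassocV (tmap id (galois1 D2) w))).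
Proof.
move: w; apply: (tens3_unique
  (g := tmap id (galois1 D3) \o @tassoc K _ _ _ \o tmap (galois2 D4) id \o
        @tassocV K _ _ _)
  (h := @tassoc K _ _ _ \o tmap (galois2 D1) id \o @tassocV K _ _ _ \o
        tmap id (galois1 D2)))
  => // a b c.
rewrite /= tassocVE !tmapE // galois1E // galois2E //.
transitivity (tmap (nmul a) (tmap id (nmul^~ c)) (tmap id D3 (D4 b))).
  move: (D4 b).
  apply: (tlift_unique
    (g := tmap id (galois1 D3) \o @tassoc K _ _ _ \o (tens (B := C))^~ c \o
          tmap (nmul a) id)
    (h := tmap (nmul a) (tmap id (nmul^~ c)) \o tmap id D3)) => // x y.
  by rewrite /= !tmapE // tassocE !tmapE // galois1E.
rewrite -coassoc -tassoc_tmap //; move: (D2 b).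
apply: (tlift_unique
  (g := @tassoc K _ _ _ \o tmap (tmap (nmul a) id) (nmul^~ c) \o tmap D1 id)
  (h := @tassoc K _ _ _ \o tmap (galois2 D1) id \o @tassocV K _ _ _ \o
        tens a \o tmap id (nmul^~ c))) => // x y.
by rewrite /= !tmapE // tassocVE !tmapE // galois2E.
Qed.

(** The element [w] is a preimage of u ⊗ x ⊗ v under the common composite in [galois_coassoc]. It is
    obtained by inverting I ⊗ T^1 on [Y ⊗ v]; the other identity follows after applying the
    injective map I ⊗ T^1 of [D3]. *)
Lemma galois_witness (G1V : tensor P C -> tensor Q C) (u : A) (v : C) x X Y :
  linear G1V -> cancel G1V (galois1 D2) -> injective (tmap (@id A) (galois1 D3)) ->
  galois1 D3 X = x ⊗ v -> galois2 D1 Y = u ⊗ x ->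
  exists w : tensor A (tensor Q C),
    tmap (galois2 D4) id (tassocV w) = tassocV (u ⊗ X) /\
    tmap id (galois1 D2) w = tassoc (Y ⊗ v).
Proof.
move=> lV VK inj hX hY; exists (tmap id G1V (tassoc (Y ⊗ v))).
have e2 : tmap id (galois1 D2) (tmap id G1V (tassoc (Y ⊗ v))) = tassoc (Y ⊗ v).
  by rewrite (@tmap_can K) //; apply: galois1_linear.
split=> //; apply: (can_inj (@tassocK _ _ _ _)); apply: inj.
by rewrite galois_coassoc e2 tassocK tmapE // hY tassocE tassocVK tmapE // hX.
Qed.
End Coassociative.

(** The composite sends a ⊗ b to a_(1) ⊗ s(a_(2)) t(a_(3)) b, which [anti] and [counit] collapse to
    a ⊗ b. Taking one of [s], [t] to be the antipode and the other the identity covers both orders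
    of composing T^1 with its inverse. *)
Lemma galois1_comp (A B B' E G U : nalgType K) (D : G -> tensor A B)
    (D' : A -> tensor G B') (M : A -> tensor A U) (N : U -> tensor B B')
    (s : B -> E) (t : B' -> E) (ε : U -> K) (u : E) :
  linear D -> linear D' -> linear M -> linear N -> linear s -> linear t ->
  scalar ε -> is_unit u ->
  (forall a, tassoc (tmap D id (D' a)) = tmap id N (M a)) ->
  (forall x, tmul (tmap s t (N x)) = ε x *: u) ->
  (forall a, contractr ε (M a) = a) ->
  cancel (galois1 (tmap id t \o D')) (galois1 (tmap id s \o D)).
Proof.
move=> lD lD' lM lN ls lt lε hu coa anti counit.
apply: (tlift_unique
  (g := galois1 (tmap id s \o D) \o galois1 (tmap id t \o D'))) => // a b.
pose k := (nmul^~ b) \o @tmul K E \o tmap s t.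
transitivity (tmap id k (tassoc (tmap D id (D' a)))).
  rewrite /= galois1E //=; move: (D' a).
  apply: (tlift_unique
    (g := galois1 (tmap id s \o D) \o tmap id (nmul^~ b) \o tmap id t)
    (h := tmap id k \o @tassoc K _ _ _ \o tmap D id)); rewrite /k // => p q.
  rewrite /= !tmapE // galois1E //=; move: (D p).
  apply: (tlift_unique (g := tmap id (nmul^~ (t q ** b)) \o tmap id s)
    (h := tmap id k \o @tassoc K _ _ _ \o (tens (B := B'))^~ q)); rewrite /k // => x y.
  by rewrite /= tassocE !tmapE //= !tmapE // tmulE nmulA.
rewrite coa -[in RHS](counit a); move: (M a).
apply: (tlift_unique (g := tmap id k \o tmap id N)
  (h := (tens (B := E))^~ b \o contractr ε)); rewrite /k // => x y.
by rewrite /= !tmapE //= anti nmulZl is_unitL // contractrE // tensZl tensZr.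
Qed.

(** Mirror image: a ⊗ b goes to a t(b_(1)) s(b_(2)) ⊗ b_(3). *)
Lemma galois2_comp (A B B' E G U : nalgType K) (D : G -> tensor B A)
    (D' : A -> tensor B' G) (M : A -> tensor U A) (N : U -> tensor B' B)
    (s : B -> E) (t : B' -> E) (ε : U -> K) (u : E) :
  linear D -> linear D' -> linear M -> linear N -> linear s -> linear t ->
  scalar ε -> is_unit u ->
  (forall a, tassoc (tmap N id (M a)) = tmap id D (D' a)) ->
  (forall x, tmul (tmap t s (N x)) = ε x *: u) ->
  (forall a, contractl ε (M a) = a) ->
  cancel (galois2 (tmap t id \o D')) (galois2 (tmap s id \o D)).
Proof.
move=> lD lD' lM lN ls lt lε hu coa anti counit.
apply: (tlift_unique
  (g := galois2 (tmap s id \o D) \o galois2 (tmap t id \o D'))) => // a b.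
pose k := (nmul a) \o @tmul K E \o tmap t s.
transitivity (tmap k id (tassocV (tmap id D (D' b)))).
  rewrite /= galois2E //=; move: (D' b).
  apply: (tlift_unique
    (g := galois2 (tmap s id \o D) \o tmap (nmul a) id \o tmap t id)
    (h := tmap k id \o @tassocV K _ _ _ \o tmap id D)); rewrite /k // => p q.
  rewrite /= !tmapE // galois2E //=; move: (D q).
  apply: (tlift_unique (g := tmap (nmul (a ** t p)) id \o tmap s id)
    (h := tmap k id \o @tassocV K _ _ _ \o tens p)); rewrite /k // => x y.
  by rewrite /= tassocVE !tmapE //= !tmapE // tmulE nmulA.
rewrite -coa tassocK -[in RHS](counit b); move: (M b).
apply: (tlift_unique (g := tmap k id \o tmap N id)
  (h := tens a \o contractl ε)); rewrite /k // => x y.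
by rewrite /= !tmapE //= anti nmulZr is_unitR // contractlE // tensZl tensZr.
Qed.
End GaloisTheory.

(** * Counit and antipode from bijective Galois maps *)

Section CounitAntipode.
Variables (K : fieldType) (pi : groupType) (A : pi -> nalgType K).
Variables (one : forall α, A α).
Variable D : forall α β γ : pi, (α * β)%g = γ -> A γ -> tensor (A α) (A β).
Hypotheses (oneP : forall α, is_unit (one α)).
Hypotheses (lD : forall α β γ (e : (α * β)%g = γ), linear (D e)).
Hypotheses (mD : forall α β γ (e : (α * β)%g = γ), {morph D e : x y / x ** y}).
Hypotheses (oneD : forall α β γ (e : (α * β)%g = γ), D e (one γ) = one α ⊗ one β).
Hypotheses (coassocD : forall α β γ p q r (e1 : (α * β)%g = p) (e2 : (p * γ)%g = q)
  (e3 : (β * γ)%g = r) (e4 : (α * r)%g = q) (a : A q),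
  tassoc (tmap (D e1) id (D e2 a)) = tmap id (D e3) (D e4 a)).
Hypotheses (bij1 : forall α β γ (e : (α * β)%g = γ), bijective (galois1 (D e))).
Hypotheses (bij2 : forall α β γ (e : (α * β)%g = γ), bijective (galois2 (D e))).

Let ginv (T U : Type) (f : T -> U) (bf : bijective f) :
  {g | cancel f g /\ cancel g f}.
Proof. by apply: cid; case: bf => g fK gK; exists g. Qed.

Let G1V α β γ (e : (α * β)%g = γ) := projT1 (ginv (bij1 e)).
Let G2V α β γ (e : (α * β)%g = γ) := projT1 (ginv (bij2 e)).

Let G1K α β γ (e : (α * β)%g = γ) : cancel (galois1 (D e)) (G1V e).
Proof. exact: (projT2 (ginv (bij1 e))).1. Qed.
Let G1VK α β γ (e : (α * β)%g = γ) : cancel (G1V e) (galois1 (D e)).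
Proof. exact: (projT2 (ginv (bij1 e))).2. Qed.
Let G2K α β γ (e : (α * β)%g = γ) : cancel (galois2 (D e)) (G2V e).
Proof. exact: (projT2 (ginv (bij2 e))).1. Qed.
Let G2VK α β γ (e : (α * β)%g = γ) : cancel (G2V e) (galois2 (D e)).
Proof. exact: (projT2 (ginv (bij2 e))).2. Qed.

Let lG1 α β γ (e : (α * β)%g = γ) : linear (galois1 (D e)).
Proof. by []. Qed.
Let lG2 α β γ (e : (α * β)%g = γ) : linear (galois2 (D e)).
Proof. by []. Qed.
Let lG1V α β γ (e : (α * β)%g = γ) : linear (G1V e).
Proof. exact: can_linear (lG1 e) (G1K e) (G1VK e). Qed.
Let lG2V α β γ (e : (α * β)%g = γ) : linear (G2V e).
Proof. exact: can_linear (lG2 e) (G2K e) (G2VK e). Qed.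

(** The inverse of a right linear bijection is right linear. *)
Let G1V_tens α β γ (e : (α * β)%g = γ) x b :
  G1V e (x ⊗ b) = tmap id (nmul^~ b) (G1V e (x ⊗ one β)).
Proof.
apply: (can_inj (G1K e)); rewrite [RHS](galois1_mulr _ (lD e) _) /= !G1VK.
by rewrite tmapE //= is_unitL.
Qed.

Let G2V_tens α β γ (e : (α * β)%g = γ) a x :
  G2V e (a ⊗ x) = tmap (nmul a) id (G2V e (one α ⊗ x)).
Proof.
apply: (can_inj (G2K e)); rewrite [RHS](galois2_mull _ (lD e) _) /= !G2VK.
by rewrite tmapE //= is_unitR.
Qed.

Let witness α β γ p q r (e1 : (α * β)%g = p) (e2 : (p * γ)%g = q)
    (e3 : (β * γ)%g = r) (e4 : (α * r)%g = q) (x : A β) :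
  exists w : tensor (A α) (tensor (A q) (A γ)),
    tmap (galois2 (D e4)) id (tassocV w) = tassocV (one α ⊗ G1V e3 (x ⊗ one γ)) /\
    tmap id (galois1 (D e2)) w = tassoc (G2V e1 (one α ⊗ x) ⊗ one γ).
Proof.
have coa := coassocD e1 e2 e3 e4.
apply: (galois_witness (lD e1) (lD e2) (lD e3) (lD e4) coa (lG1V e2));
  rewrite ?G1VK ?G2VK //.
by apply: (can_inj (g := tmap id (G1V e3))); apply: tmap_can => //; apply: G1K.
Qed.

(** [E β x] and [F α x] turn out to be ε(x) times the units of A_β and A_α. *)
Let E β (x : A 1%g) : A β := tmul (G1V (mul1g β) (x ⊗ one β)).
Let F α (x : A 1%g) : A α := tmul (G2V (mulg1 α) (one α ⊗ x)).

(** For x in A_1 the outer Galois maps of the witness, T^2 and T^1, both belong to Δ_{α,β}, so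
    [galois_exchange] applies to [w] and multiplies out its two descriptions. *)
Let EF α β x : one α ⊗ E β x = F α x ⊗ one β.
Proof.
have [w [e1 e2]] := witness (mulg1 α) (erefl (α * β)%g) (mul1g β) (erefl _) x.
have := galois_exchange w (lD (erefl (α * β)%g)).
by rewrite e1 e2 tassocK tassocVK !tmapE.
Qed.

(* If A_1 = 0, then every A_β is 0 and f = 0 will do; otherwise the condition
   says that f 1 = 1. *)
Lemma counit_functional : exists2 f : A 1%g -> K, scalar f &
  forall β (b : A β), f (one 1%g) *: b = b.
Proof.
have [one0|/linear_functional [f lf f1]] := eqVneq (one 1%g) 0; last first.
  by exists f => // β b; rewrite f1 scale1r.
exists (fun=> 0) => [k x y|β b]; first by rewrite mulr0 addr0.
have A1 (x : A 1%g) : x = 0 by rewrite -(is_unitR x (@oneP _)) one0 nmul0r.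
have AA : forall z : tensor (A 1%g) (A β), z = 0.
  apply: (tlift_unique (h := fun=> 0)) => // [k x y|x y].
    by rewrite scaler0 addr0.
  by rewrite (A1 x); apply: (lin0 (lin_tensr y)).
(* b is the product of the legs of b ⊗ 1, and T^1 maps b ⊗ 1 injectively into A_1 ⊗ A_β = 0. *)
rewrite scale0r -[b](is_unitR b (@oneP _)) -tmulE.
rewrite -[b ⊗ _](G1K (mul1g β)) (AA (galois1 _ _)).
by rewrite (lin0 (lG1V _)) (lin0 (@tmul_linear _ _)).
Qed.

Lemma counit_antipode : exists (ε : A 1%g -> K) (S : forall α, A α^-1%g -> A α),
  [/\ scalar ε, forall a b, ε (a ** b) = ε a * ε b,
      one 1%g <> 0 -> ε (one 1%g) = 1 & forall α, linear (@S α)] /\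
  [/\ forall α (e : (α * 1)%g = α) a, contractr ε (D e a) = a,
      forall α (e : (1 * α)%g = α) a, contractl ε (D e a) = a,
      forall α (e : (α^-1 * α)%g = 1%g) a,
        tmul (tmap (@S α) id (D e a)) = ε a *: one α &
      forall α (e : (α * α^-1)%g = 1%g) a,
        tmul (tmap id (@S α) (D e a)) = ε a *: one α].
Proof.
have [f lf f1] := counit_functional.
have lF α : linear (@F α).
  apply: (lin_comp (@tmul_linear _ _)).
  exact: (lin_comp (lG2V _) (lin_tensl _)).
have fZ k x : f (k *: x) = k * f x.
  have f0 : f 0 = 0 by have := lf (-1) 0 0; rewrite scaler0 addr0 mulN1r addNr.
  by rewrite -[k *: x]addr0 lf f0 addr0.
(* [F 1 x] is to be a multiple of the unit of A_1, and [f] reads off the scalar. *)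
pose ε x := f (F 1%g x).
have lε : scalar ε by move=> k x y; rewrite /ε lF lf.
have f1x x : f x * f (one 1%g) = f x by rewrite mulrC -fZ f1.
(* Applying [f] to the first leg of [EF] with α = 1, and then to the second leg with β = 1,
   identifies both families. *)
have EE β x : E β x = ε x *: one β.
  have := congr1 (contractl f) (EF 1%g β x).
  by rewrite !contractlE // f1.
have FE α x : F α x = ε x *: one α.
  have := congr1 (contractr f) (EF α 1%g x).
  by rewrite !contractrE // f1 EE fZ f1x => <-.
(* (ε ⊗ I) T^1 = m, because m (T^1)^-1 is right linear and sends x ⊗ 1 to [E β x], which is ε(x)
   1. *)
have epsL β z : contractl ε (galois1 (D (mul1g β)) z) = tmul z.
  rewrite -[in RHS](G1K (mul1g β) z); move: (galois1 _ z).
  apply: (tlift_unique (h := @tmul K _ \o G1V (mul1g β))) => // x b.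
  rewrite contractlE //= G1V_tens.
  have -> : tmul (tmap id (nmul^~ b) (G1V (mul1g β) (x ⊗ one β))) = E β x ** b.
    rewrite /E; move: (G1V _ _); apply: (tlift_unique
      (g := @tmul K _ \o tmap id (nmul^~ b)) (h := (nmul^~ b) \o @tmul K _)) => // c d.
    by rewrite /= tmapE // !tmulE nmulA.
  by rewrite EE nmulZl is_unitL.
have epsR α z : contractr ε (galois2 (D (mulg1 α)) z) = tmul z.
  rewrite -[in RHS](G2K (mulg1 α) z); move: (galois2 _ z).
  apply: (tlift_unique (h := @tmul K _ \o G2V (mulg1 α))) => // a x.
  rewrite contractrE //= G2V_tens.
  have -> : tmul (tmap (nmul a) id (G2V (mulg1 α) (one α ⊗ x))) = a ** F α x.
    rewrite /F; move: (G2V _ _); apply: (tlift_unique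
      (g := @tmul K _ \o tmap (nmul a) id) (h := (nmul a) \o @tmul K _)) => // c d.
    by rewrite /= tmapE // !tmulE nmulA.
  by rewrite FE nmulZr is_unitR.
(* Evaluate [epsL] at a ⊗ 1, where T^1 gives Δ(a) and m gives a. *)
have counitl α (e : (1 * α)%g = α) a : contractl ε (D e a) = a.
  rewrite (Prop_irrelevance e (mul1g α)).
  rewrite -(galois1_one (lD _) (@oneP 1%g) (@oneP α)) epsL tmulE.
  exact: is_unitR.
have counitr α (e : (α * 1)%g = α) a : contractr ε (D e a) = a.
  rewrite (Prop_irrelevance e (mulg1 α)).
  rewrite -(galois2_one (lD _) (@oneP α) (@oneP 1%g)) epsR tmulE.
  exact: is_unitL.
(* Coefficients of the unit are compared through [f], which stays valid when A_1 = 0. *)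
have fε x k : ε x *: one 1%g = k *: one 1%g -> ε x = k * f (one 1%g).
  by move/(congr1 f); rewrite !fZ f1x.
(* The map φ = ε ⊗ id satisfies φ T^1 = m, hence is multiplicative because Δ is. *)
pose φ := @contractl K (A 1%g) (A 1%g) ε.
have lφ : linear φ by apply: contractl_linear.
have φD a z : φ (D (mul1g 1%g) a ** z) = a ** φ z.
  rewrite -[z](G1VK (mul1g 1%g)); move: (G1V _ z).
  apply: (tlift_unique (g := φ \o nmul (D (mul1g 1%g) a) \o galois1 (D (mul1g 1%g)))
    (h := nmul a \o φ \o galois1 (D (mul1g 1%g)))) => // c d.
  rewrite /= {2}/φ epsL tmulE (galois1_mul (lD _) (@oneP _)).
  rewrite nmulA -mD -(galois1_mul (lD _) (@oneP _)) /φ epsL tmulE.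
  by rewrite nmulA.
have φM z w : φ (z ** w) = φ z ** φ w.
  rewrite -[z](G1VK (mul1g 1%g)); move: (G1V _ z).
  apply: (tlift_unique (g := φ \o nmul^~ w \o galois1 (D (mul1g 1%g)))
    (h := nmul^~ (φ w) \o φ \o galois1 (D (mul1g 1%g)))) => // a b.
  rewrite /= {2}/φ epsL tmulE (galois1_mul (lD _) (@oneP _)) -!nmulA φD.
  congr (_ ** _); move: w; apply: (tlift_unique (g := φ \o nmul (one _ ⊗ b))
    (h := nmul b \o φ)) => // c d.
  by rewrite /= tensM is_unitL // /φ !contractlE // nmulZr.
have εM a b : ε (a ** b) = ε a * ε b.
  have := φM (a ⊗ one _) (b ⊗ one _).
  rewrite tensM (is_unitR _ (@oneP _)) /φ !contractlE //.
  rewrite nmulZl nmulZr (is_unitR _ (@oneP _)) scalerA.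
  by move/fε => ->; rewrite -mulrA f1x.
(* Since Δ(1) = 1 ⊗ 1, the counit axiom at the unit reads ε(1) 1 = 1. *)
have ε1 : one 1%g <> 0 -> ε (one 1%g) = 1.
  move=> /eqP n0; have := counitl _ (mul1g 1%g) (one _).
  rewrite oneD contractlE // => /eqP; rewrite -subr_eq0 -[X in _ - X]scale1r.
  by rewrite -scalerBl scaler_eq0 (negPf n0) orbF subr_eq0 => /eqP.
pose S α (x : A α^-1%g) := contractl ε (G1V (mulVg α) (x ⊗ one α)).
pose S' α (x : A α^-1%g) := contractr ε (G2V (mulgV α) (one α ⊗ x)).
have lS α : linear (@S α).
  apply: (lin_comp (contractl_linear lε)).
  exact: (lin_comp (lG1V _) (lin_tensr _)).
have lS' α : linear (@S' α).
  apply: (lin_comp (contractr_linear lε)).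
  exact: (lin_comp (lG2V _) (lin_tensl _)).
have SS' α x : S α x = S' α x.
  (* The product of the three legs of [w] is computed in two ways: m = (I ⊗ ε) T^2 on the first two
     legs leads to [S α x], and m = (ε ⊗ I) T^1 on the last two leads to [S' α x]. *)
  have [w [e1 e2]] := witness (mulgV α) (mul1g α) (mulVg α) (mulg1 α) x.
  have h : tmul (tmap (@tmul K _) id (tassocV w)) = tmul (tmap id (@tmul K _) w).
    move: w {e1 e2}; apply: (tens3_unique
      (g := @tmul K _ \o tmap (@tmul K _) id \o @tassocV K _ _ _)
      (h := @tmul K _ \o tmap id (@tmul K _))) => // a b c.
    by rewrite /= tassocVE !tmapE // !tmulE nmulA.
  have hl : tmul (tmap (@tmul K _) id (tassocV w)) = S α x.
    have <- : tmap (contractr ε \o galois2 (D (mulg1 α))) id (tassocV w) =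
              tmap (@tmul K (A α)) id (tassocV w).
      by congr (tmap _ _ _); apply: funext => z; rewrite /= epsR.
    rewrite -(tmap_comp (lG2 _) (contractr_linear lε) (@lin_id _ _) (@lin_id _ _)).
    rewrite /= e1 /S; move: (G1V _ _).
    apply: (tlift_unique (g := @tmul K _ \o tmap (contractr ε) id \o
      @tassocV K _ _ _ \o tens (one α))) => // y b.
    rewrite /= tassocVE tmapE // contractrE // contractlE // tmulE nmulZl.
    by rewrite is_unitL.
  have hr : tmul (tmap id (@tmul K _) w) = S' α x.
    have <- : tmap id (contractl ε \o galois1 (D (mul1g α))) w =
              tmap id (@tmul K (A α)) w.
      by congr (tmap _ _ _); apply: funext => z; rewrite /= epsL.
    rewrite -(tmap_comp (@lin_id _ _) (@lin_id _ _) (lG1 _) (contractl_linear lε)).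
    rewrite /= e2 /S'; move: (G2V _ _).
    apply: (tlift_unique (g := @tmul K _ \o tmap id (contractl ε) \o
      @tassoc K _ _ _ \o (tens (B := A α))^~ (one α))) => // y b.
    rewrite /= tassocE tmapE // contractrE // contractlE // tmulE nmulZr.
    by rewrite is_unitR.
  by rewrite -hl h hr.
exists ε, S; split; split=> // α e a.
- rewrite (Prop_irrelevance e (mulVg α)).
  (* By right linearity m (S ⊗ I) = (ε ⊗ I) (T^1)^-1, and Δ(a) = T^1(a ⊗ 1). *)
  transitivity (contractl ε (G1V (mulVg α) (D (mulVg α) a))).
    move: (D _ a); apply: (tlift_unique (g := @tmul K _ \o tmap (@S α) id)
      (h := contractl ε \o G1V (mulVg α))) => // x b.
    rewrite /= tmapE // tmulE G1V_tens /S; move: (G1V _ _).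
    apply: (tlift_unique (g := nmul^~ b \o contractl ε)
      (h := contractl ε \o tmap id (nmul^~ b))) => // y c.
    by rewrite /= tmapE // !contractlE // nmulZl.
  by rewrite -(galois1_one (lD _) (@oneP _) (@oneP α)) G1K contractlE.
- rewrite (Prop_irrelevance e (mulgV α)).
  have <- : tmap id (@S' α) (D (mulgV α) a) = tmap id (@S α) (D (mulgV α) a).
    by congr (tmap _ _ _); apply: funext => x; rewrite SS'.
  transitivity (contractr ε (G2V (mulgV α) (D (mulgV α) a))).
    move: (D _ a); apply: (tlift_unique (g := @tmul K _ \o tmap id (@S' α))
      (h := contractr ε \o G2V (mulgV α))) => // b x.
    rewrite /= tmapE // tmulE G2V_tens /S'; move: (G2V _ _).
    apply: (tlift_unique (g := nmul b \o contractr ε)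
      (h := contractr ε \o tmap (nmul b) id)) => // c y.
    by rewrite /= tmapE // !contractrE // nmulZr.
  by rewrite -(galois2_one (lD _) (@oneP α) (@oneP _)) G2K contractrE.
Qed.
End CounitAntipode.

(** * Antipode sums as composites of maps, and transport between equal indices *)

Lemma tlift_nmull (K : fieldType) (V : lmodType K) (A : nalgType K) (f : V -> A) :
  linear f -> tlift (fun x y => f x ** y) =1 @tmul K A \o tmap f id.
Proof.
move=> lf; have bf : bilin (fun x y => f x ** y).
  by split=> [y|x] k p q /=; rewrite ?lf ?nmulPl ?nmulPr.
apply: tlift_unique => [||x y]; [exact: tlift_linear bf|by []|].
by rewrite (tliftE bf) /= tmapE // tmulE.
Qed.

Lemma tlift_nmulr (K : fieldType) (V : lmodType K) (A : nalgType K) (f : V -> A) :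
  linear f -> tlift (fun x y => x ** f y) =1 @tmul K A \o tmap id f.
Proof.
move=> lf; have bf : bilin (fun x y => x ** f y).
  by split=> [y|x] k p q /=; rewrite ?lf ?nmulPl ?nmulPr.
apply: tlift_unique => [||x y]; [exact: tlift_linear bf|by []|].
by rewrite (tliftE bf) /= tmapE // tmulE.
Qed.

Section Comul.
Variables (K : fieldType) (pi : groupType) (A : pi -> nalgType K).

Lemma castA_linear x y (e : x = y) : linear (@castA K pi A x y e).
Proof. by case: y / e. Qed.

Lemma castAK x y (e : x = y) (a : A x) : castA (esym e) (castA e a) = a.
Proof. by case: y / e. Qed.

Lemma castAVK x y (e : x = y) (a : A y) : castA e (castA (esym e) a) = a.
Proof. by case: y / e a. Qed.

(** Used with β = (α^-1)^-1, to pass from maps A_{α^-1} -> A_α to an antipode defined on A_α. *)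
Lemma castA_inv (S : forall α, A α^-1%g -> A α) α β (e : β = α)
    (e' : α^-1%g = β^-1%g) x : castA e (S β (castA e' x)) = S α x.
Proof. by case: α / e e' x => e' x; rewrite (Prop_irrelevance e' erefl). Qed.

Variable δ : forall α β, A (α * β)%g -> tensor (A α) (A β).

(* Replacing the index αβ by an equal one keeps the transports of Defs out of
   the computations. *)
Definition comul_at α β γ (e : (α * β)%g = γ) (a : A γ) : tensor (A α) (A β) :=
  δ (castA (esym e) a).

Lemma comul_at_linear α β γ (e : (α * β)%g = γ) :
  linear (@δ α β) -> linear (comul_at e).
Proof. by case: γ / e. Qed.

Lemma comul_at_coassoc α β γ p q r (e1 : (α * β)%g = p) (e2 : (p * γ)%g = q)
    (e3 : (β * γ)%g = r) (e4 : (α * r)%g = q) :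
  (forall a : A (α * β * γ)%g,
    tassoc (tmap (@δ α β) id (δ a)) =
    tmap id (@δ β γ) (δ (castA (esym (mulgA α β γ)) a))) ->
  forall a : A q,
  tassoc (tmap (comul_at e1) id (comul_at e2 a)) =
  tmap id (comul_at e3) (comul_at e4 a).
Proof.
case: p / e1 e2 => e2; case: q / e2 e4; case: r / e3 => e4 coa a.
by rewrite (Prop_irrelevance e4 (mulgA α β γ)); apply: coa.
Qed.
End Comul.

(** * Bijectivity of the Galois maps of a Hopf π-coalgebra *)

Section Bijective.
Variables (K : fieldType) (pi : groupType) (A : pi -> nalgType K).
Variables (one : forall α, A α).
Variable D : forall α β γ : pi, (α * β)%g = γ -> A γ -> tensor (A α) (A β).
Variables (ε : A 1%g -> K) (S : forall α, A α^-1%g -> A α).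
Hypotheses (oneP : forall α, is_unit (one α)).
Hypotheses (lD : forall α β γ (e : (α * β)%g = γ), linear (D e)).
Hypotheses (coassocD : forall α β γ p q r (e1 : (α * β)%g = p) (e2 : (p * γ)%g = q)
  (e3 : (β * γ)%g = r) (e4 : (α * r)%g = q) (a : A q),
  tassoc (tmap (D e1) id (D e2 a)) = tmap id (D e3) (D e4 a)).
Hypotheses (lε : scalar ε) (lS : forall α, linear (@S α)).
Hypothesis counitr : forall α (e : (α * 1)%g = α) a, contractr ε (D e a) = a.
Hypothesis counitl : forall α (e : (1 * α)%g = α) a, contractl ε (D e a) = a.
Hypothesis antipodel : forall α (e : (α^-1 * α)%g = 1%g) a,
  tmul (tmap (@S α) id (D e a)) = ε a *: one α.
Hypothesis antipoder : forall α (e : (α * α^-1)%g = 1%g) a,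
  tmul (tmap id (@S α) (D e a)) = ε a *: one α.

Lemma galois1_bij α β γ (e : (α * β)%g = γ) : bijective (galois1 (D e)).
Proof.
have e' : (γ * β^-1)%g = α by rewrite -e mulgK.
(* This puts T^1 in the shape required by [galois1_comp], with the identity in place of the
   antipode. *)
have De : tmap id id \o D e = D e by apply: funext => x; rewrite /= tmap_id.
exists (galois1 (tmap id (@S β) \o D e')); rewrite -{1}De.
  apply: (galois1_comp (M := D (mulg1 γ)) (N := D (mulVg β)) (ε := ε)
    (u := one β)) => //.
apply: (galois1_comp (M := D (mulg1 α)) (N := D (mulgV β)) (ε := ε)
  (u := one β)) => //.
Qed.

Lemma galois2_bij α β γ (e : (α * β)%g = γ) : bijective (galois2 (D e)).
Proof.
have e' : (α^-1 * γ)%g = β by rewrite -e mulKg.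
have De : tmap id id \o D e = D e by apply: funext => x; rewrite /= tmap_id.
exists (galois2 (tmap (@S α) id \o D e')); rewrite -{1}De.
  apply: (galois2_comp (M := D (mul1g γ)) (N := D (mulgV α)) (ε := ε)
    (u := one α)) => //.
apply: (galois2_comp (M := D (mul1g β)) (N := D (mulVg α)) (ε := ε)
  (u := one α)) => //.
Qed.
End Bijective.

(** * Coassociativity multiplied on the outer legs *)

Section CoassociativeUnital.
Variables (K : fieldType) (A B C P Q R : nalgType K) (u : A) (v : B) (w : C).
Hypotheses (hu : is_unit u) (hv : is_unit v) (hw : is_unit w).

(* With coassoc_rhsE: both sides of the coassociativity axiom of a multiplier Hopf
   π-coalgebra are (a ⊗ 1 ⊗ 1) _ (1 ⊗ 1 ⊗ c) applied to those of coassociativity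
   for D. *)
Lemma coassoc_lhsE (D1 : P -> tensor A B) (D2 : Q -> tensor P C) a b c :
  linear D1 -> linear D2 ->
  tassoc (((a ⊗ v) ⊗ w) ** tmap D1 id (galois1 D2 (b ⊗ c))) =
  tmap (nmul a) (tmap id (nmul^~ c)) (tassoc (tmap D1 id (D2 b))).
Proof.
move=> l1 l2; rewrite galois1E // -tassoc_tmap //; congr tassoc; move: (D2 b).
apply: (tlift_unique (g := nmul ((a ⊗ v) ⊗ w) \o tmap D1 id \o tmap id (nmul^~ c))
  (h := tmap (tmap (nmul a) id) (nmul^~ c) \o tmap D1 id)) => // x y.
rewrite /= !tmapE // tensM (is_unitL _ hw); congr (_ ⊗ _); move: (D1 x).
apply: (tlift_unique (g := nmul (a ⊗ v))) => // p q.
by rewrite tensM tmapE // (is_unitL _ hv).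
Qed.

Lemma coassoc_rhsE (D3 : R -> tensor B C) (D4 : Q -> tensor A R) a b c :
  linear D3 -> linear D4 ->
  tmap id D3 (galois2 D4 (a ⊗ b)) ** (u ⊗ (v ⊗ c)) =
  tmap (nmul a) (tmap id (nmul^~ c)) (tmap id D3 (D4 b)).
Proof.
move=> l3 l4; rewrite galois2E //; move: (D4 b).
apply: (tlift_unique (g := nmul^~ (u ⊗ (v ⊗ c)) \o tmap id D3 \o tmap (nmul a) id)
  (h := tmap (nmul a) (tmap id (nmul^~ c)) \o tmap id D3)) => // x y.
rewrite /= !tmapE // tensM (is_unitR _ hu); congr (_ ⊗ _); move: (D3 y).
apply: (tlift_unique (g := nmul^~ (v ⊗ c))) => // p q.
by rewrite tensM tmapE // (is_unitR _ hv).
Qed.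

(** For a = 1 and c = 1 the outer factors disappear, which recovers coassociativity from the
    multiplier axiom. *)
Lemma coassoc_one (z : tensor A (tensor B C)) :
  tmap (nmul u) (tmap id (nmul^~ w)) z = z.
Proof.
move: z; apply: (tens3_unique (h := id)) => // a b c.
by rewrite !tmapE // (is_unitL _ hu) (is_unitR _ hw).
Qed.
End CoassociativeUnital.

(** * The two implications for unital components, with Δ factored through δ *)

Section Equivalence.
Variables (K : fieldType) (pi : groupType) (A : pi -> nalgType K).
Variable Δ : forall α β : pi, A (α * β)%g -> multiplier (tensor (A α) (A β)).
Variable one : forall α, A α.
Variable δ : forall α β : pi, A (α * β)%g -> tensor (A α) (A β).
Arguments Δ : clear implicits.
Arguments one : clear implicits.
Hypothesis oneP : forall α, is_unit (one α).
Hypothesis Δδ : forall α β a, Δ α β a = memb (δ a).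

Let one2P α β : is_unit (one α ⊗ one β).
Proof. exact: is_unit_tens. Qed.

Lemma comul_mulr α β a b : linear (@δ α β) ->
  Δ α β a ** mtens (mult1 _) (memb b) = memb (galois1 (@δ α β) (a ⊗ b)).
Proof.
move=> l; rewrite Δδ (mult1_memb (@oneP α)) -memb_tens.
by rewrite (galois1_mul l (@oneP α)) (memb_hom _).2.
Qed.

Lemma comul_mull α β a b : linear (@δ α β) ->
  mtens (memb b) (mult1 _) ** Δ α β a = memb (galois2 (@δ α β) (b ⊗ a)).
Proof.
move=> l; rewrite Δδ (mult1_memb (@oneP β)) -memb_tens.
by rewrite (galois2_mul l (@oneP β)) (memb_hom _).2.
Qed.

Lemma comul_id_memb α β γ z : is_alg_hom (Δ α β) -> linear (@δ α β) ->
  comul_id (γ := γ) Δ z = memb (tmap (@δ α β) id z).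
Proof.
move=> h l; move: z; apply: (tlift_unique (h := @memb K _ \o tmap (@δ α β) id)).
- apply: tlift_linear; case: h => l' _.
  have [tl tr] := mtens_bilin (tensor (A α) (A β)) (A γ).
  by split=> [y|y] k u v /=; rewrite ?l' ?(memb_hom _).1 ?(tl _ k) ?(tr _ k).
- by apply: lin_comp => //; apply: (memb_hom _).1.
- by move=> x c; rewrite comul_idE //= tmapE // Δδ memb_tens.
Qed.

Lemma id_comul_memb α β γ z : is_alg_hom (Δ β γ) -> linear (@δ β γ) ->
  id_comul (α := α) Δ z = memb (tmap id (@δ β γ) z).
Proof.
move=> h l; move: z; apply: (tlift_unique (h := @memb K _ \o tmap id (@δ β γ))).
- apply: tlift_linear; case: h => l' _.
  have [tl tr] := mtens_bilin (A α) (tensor (A β) (A γ)).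
  by split=> [y|y] k u v /=; rewrite ?l' ?(memb_hom _).1 ?(tl _ k) ?(tr _ k).
- by apply: lin_comp => //; apply: (memb_hom _).1.
- by move=> x c; rewrite id_comulE //= tmapE // Δδ memb_tens.
Qed.

Hypothesis homΔ : forall α β, is_alg_hom (Δ α β).

(** The embedding [memb] is an injective homomorphism, so multiplicativity and linearity descend
    from Δ to δ. *)
Lemma multiplier_comul_hom α β : is_alg_hom (@δ α β).
Proof.
by split=> [k x y|x y]; apply: (memb_unit_inj (@one2P α β));
  rewrite ?(memb_hom _).1 ?(memb_hom _).2 -!Δδ;
  [apply: (homΔ _ _).1|apply: (homΔ _ _).2].
Qed.

Lemma coassoc_lhs_memb α β γ (a : A α) b (c : A γ) :
  (forall α β, linear (@δ α β)) ->
  massoc (mtens (mtens (memb a) (mult1 (A β))) (mult1 (A γ)) **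
    comul_id Δ (galois1 (@δ (α * β)%g γ) (b ⊗ c))) =
  memb (tmap (nmul a) (tmap id (nmul^~ c)) (tassoc (tmap (@δ α β) id (δ b)))).
Proof.
move=> l; rewrite (mult1_memb (@oneP β)) (mult1_memb (@oneP γ)) -!memb_tens.
rewrite comul_id_memb // -(memb_hom _).2 massoc_memb.
by rewrite (coassoc_lhsE (@oneP β) (@oneP γ)).
Qed.

Lemma coassoc_rhs_memb α β γ (a : A α) b (c : A γ) :
  (forall α β, linear (@δ α β)) ->
  id_comul Δ (galois2 (@δ α (β * γ)%g) (a ⊗ b)) **
    mtens (mult1 (A α)) (mtens (mult1 (A β)) (memb c)) =
  memb (tmap (nmul a) (tmap id (nmul^~ c)) (tmap id (@δ β γ) (δ b))).
Proof.
move=> l; rewrite (mult1_memb (@oneP β)) (mult1_memb (@oneP α)) -!memb_tens.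
rewrite id_comul_memb // -(memb_hom _).2.
by rewrite (coassoc_rhsE (@oneP α) (@oneP β)).
Qed.

Lemma hopf_multiplier ε S :
  hopf_pi_coalgebra one (@δ) ε S -> multiplier_hopf_pi_coalgebra Δ.
Proof.
case=> _ homδ _ lε _ _ lS coa cr cl al ar.
have l α β : linear (@δ α β) by case: (homδ α β).
pose D α β γ e := comul_at (@δ) (α := α) (β := β) (γ := γ) e.
have lD α β γ (e : (α * β)%g = γ) : linear (D _ _ _ e) by apply: comul_at_linear.
pose S' α (x : A α^-1%g) := castA (invgK α) (S _ x).
have lS' α : linear (S' α).
  by apply: (lin_comp (@castA_linear _ _ _ _ _ _) (lS _)).
have coaD α β γ p q r (e1 : (α * β)%g = p) (e2 : (p * γ)%g = q)
  (e3 : (β * γ)%g = r) (e4 : (α * r)%g = q) a :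
  tassoc (tmap (D _ _ _ e1) id (D _ _ _ e2 a)) = tmap id (D _ _ _ e3) (D _ _ _ e4 a).
  by apply: comul_at_coassoc; apply: coa.
have crD α (e : (α * 1)%g = α) a : contractr ε (D _ _ _ e a) = a.
  by rewrite /D /comul_at [LHS]cr (Prop_irrelevance e (mulg1 α)) castAVK.
have clD α (e : (1 * α)%g = α) a : contractl ε (D _ _ _ e a) = a.
  by rewrite /D /comul_at [LHS]cl (Prop_irrelevance e (mul1g α)) castAVK.
have alD α (e : (α^-1 * α)%g = 1%g) a :
    tmul (tmap (S' α) id (D _ _ _ e a)) = ε a *: one α.
  rewrite (Prop_irrelevance e (mulVg α)) -[in RHS](castAVK (mulVg α) a) -al.
  exact: esym (tlift_nmull (lS' α) _).
have arD α (e : (α * α^-1)%g = 1%g) a :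
    tmul (tmap id (S' α) (D _ _ _ e a)) = ε a *: one α.
  rewrite (Prop_irrelevance e (mulgV α)) -[in RHS](castAVK (mulgV α) a) -ar.
  exact: esym (tlift_nmulr (lS' α) _).
split=> //.
- by move=> α β a b; rewrite comul_mulr //; eexists.
- by move=> α β a b; rewrite comul_mull //; eexists.
(* Injectivity of [memb] forces t = T^1(b ⊗ c) and s = T^2(a ⊗ b), up to transport of b. The axiom
   becomes coassociativity of δ multiplied by a and c on the outer legs. *)
- move=> α β γ a b c t s; rewrite comul_mulr // => /(memb_unit_inj (@one2P _ _)) ->.
  rewrite comul_mull // => /(memb_unit_inj (@one2P _ _))->.
  by rewrite coassoc_lhs_memb // coassoc_rhs_memb // coa.
- move=> α β; exists (galois1 (@δ α β)); split.
  + exact: galois1_linear.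
  + by move=> a b; rewrite comul_mulr.
  + exact: (galois1_bij oneP lD coaD lε lS' crD alD arD (erefl (α * β)%g)).
- move=> α β; exists (galois2 (@δ α β)); split.
  + exact: galois2_linear.
  + by move=> a b; rewrite comul_mull.
  + exact: (galois2_bij oneP lD coaD lε lS' clD alD arD (erefl (α * β)%g)).
Qed.

Lemma multiplier_hopf : multiplier_hopf_pi_coalgebra Δ ->
  exists ε S, hopf_pi_coalgebra one (@δ) ε S.
Proof.
case=> _ cov1 cov2 coaM b1 b2.
have homδ := multiplier_comul_hom.
have l α β : linear (@δ α β) by case: (homδ α β).
(* The given bijection agrees with [galois1] on elementary tensors once both are embedded by
   [memb]. *)
have bij1 α β : bijective (galois1 (@δ α β)).
  have [T [lT hT bT]] := b1 α β; apply: eq_bij bT _ _.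
  apply: (tlift_unique lT) => [|a b]; first exact: galois1_linear.
  by apply: (memb_unit_inj (@one2P _ _)); rewrite hT comul_mulr.
have bij2 α β : bijective (galois2 (@δ α β)).
  have [T [lT hT bT]] := b2 α β; apply: eq_bij bT _ _.
  apply: (tlift_unique lT) => [|a b]; first exact: galois2_linear.
  by apply: (memb_unit_inj (@one2P _ _)); rewrite hT comul_mull.
have coa α β γ (a : A (α * β * γ)%g) :
    tassoc (tmap (@δ α β) id (δ a)) =
    tmap id (@δ β γ) (δ (castA (esym (mulgA α β γ)) a)).
  (* The multiplier axiom is taken with units as outer factors. *)
  have := coaM α β γ (one α) a (one γ) _ _
    (esym (comul_mulr _ _ (l _ _))) (esym (comul_mull _ _ (l _ _))).
  rewrite coassoc_lhs_memb // coassoc_rhs_memb // !coassoc_one //.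
  by apply: memb_unit_inj; apply: is_unit_tens => //; apply: one2P.
(* A homomorphism need not preserve units. Here δ(1)δ(a) = δ(a), so left multiplication by δ(1)
   fixes the image of T^1, which is everything. *)
have δ1 α β : δ (one (α * β)%g) = one α ⊗ one β.
  have [g _ gK] := bij1 α β.
  have fix1 z : δ (one (α * β)%g) ** z = z.
    rewrite -[z]gK; move: (g z); apply: (tlift_unique
      (g := nmul (δ (one (α * β)%g)) \o galois1 (@δ α β))
      (h := galois1 (@δ α β))) => [||a b].
    - by apply: lin_comp; [exact: lin_nmull|exact: galois1_linear].
    - exact: galois1_linear.
    - rewrite /= (galois1_mul (l _ _) (@oneP _)) nmulA -(homδ _ _).2.
      by rewrite (is_unitL _ (@oneP _)).
  by rewrite -[LHS](is_unitR _ (@one2P α β)) fix1.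
pose D α β γ e := comul_at (@δ) (α := α) (β := β) (γ := γ) e.
have [] := @counit_antipode K pi A one D oneP.
- by move=> α β γ e; apply: comul_at_linear.
- by move=> α β γ e; rewrite /D; case: γ / e => x y; apply: (homδ _ _).2.
- by move=> α β γ e; rewrite /D; case: γ / e; apply: δ1.
- by move=> *; apply: comul_at_coassoc; apply: coa.
- by move=> α β γ e; rewrite /D; case: γ / e; apply: bij1.
- by move=> α β γ e; rewrite /D; case: γ / e; apply: bij2.
move=> ε [S [[lε εM ε1 lS] [cr cl al ar]]].
pose S' α (x : A α) : A α^-1%g := S _ (castA (esym (invgK α)) x).
have S'E α x : castA (invgK α) (S' _ x) = S α x by apply: castA_inv.
exists ε, S'; split=> //.
- move=> α; apply: (lin_comp (lS _) (@castA_linear _ _ _ _ _ _)).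
- move=> α a; have := cr α (mulg1 α) (castA (mulg1 α) a).
  by rewrite /D /comul_at castAK.
- move=> α a; have := cl α (mul1g α) (castA (mul1g α) a).
  by rewrite /D /comul_at castAK.
- move=> α a; rewrite -(al α (mulVg α)) /D /comul_at castAK.
  apply: etrans (tlift_nmull (lS α) _); congr tlift.
  by do 2 apply: funext => ?; rewrite S'E.
- move=> α a; rewrite -(ar α (mulgV α)) /D /comul_at castAK.
  apply: etrans (tlift_nmulr (lS α) _); congr tlift.
  by do 2 apply: funext => ?; rewrite S'E.
Qed.
End Equivalence.

(** * The equivalence over the complex numbers *)

Theorem theorem3 (R : realType) (pi : groupType) (A : pi -> nalgType R[i])
    (Δ : forall α β : pi, A (α * β)%g -> multiplier (tensor (A α) (A β)))
    (nondegA : forall α : pi, nondegenerate_mul (A α))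
    (homΔ : forall α β : pi, is_alg_hom (Δ α β)) :
  (exists (one : forall α : pi, A α)
          (δ : forall α β : pi, A (α * β)%g -> tensor (A α) (A β))
          (ε : A 1%g -> R[i])
          (S : forall α : pi, A α -> A (α^-1)%g),
      (forall (α β : pi) (a : A (α * β)%g), Δ α β a = memb (δ α β a)) /\
      hopf_pi_coalgebra one δ ε S)
  <->
  (multiplier_hopf_pi_coalgebra Δ /\ forall α : pi, unital (A α)).
Proof.
split=> [[one [δ [ε [S [Δδ H]]]]]|[H unitalA]].
  have oneP := hopf_one H; split; last by move=> α; exists (one α).
  exact: hopf_multiplier oneP Δδ homΔ ε S H.
pose one α := projT1 (cid (unitalA α)).
have oneP α : is_unit (one α) := projT2 (cid (unitalA α)).
(* The multiplier Δ(a) of a unital algebra is multiplication by its value at the unit 1 ⊗ 1. *)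
pose δ α β (a : A (α * β)%g) := mulL (Δ α β a) (one α ⊗ one β).
have Δδ α β a : Δ α β a = memb (δ α β a).
  by apply: memb_surj; apply: is_unit_tens.
have [ε [S HS]] := multiplier_hopf oneP Δδ homΔ H.
by exists one, δ, ε, S.
Qed.
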